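(* For $0<s<1$ let $x_c(s)$ be the radius of convergence of $G(x,1,s,s)=\sum_{\pi\in\mathcal D}x^{n(\pi)}s^{a(\pi)+w(\pi)}$ as a power series in $x$. Then $$x_c(s)=\min_{k\ge1}x_k(s),\qquad x_k(s)=\frac{1}{4s^{2k}\cos^2\left(\frac{\pi}{k+2}\right)}.$$ Consecutive branches $x_k(s)$ and $x_{k+1}(s)$ cross at $$s_k=\frac{\cos(\pi/(k+2))}{\cos(\pi/(k+3))},$$ with corresponding value $\xi_k=x_k(s_k)$, and as $k\to\infty$ $$s_k=1-\frac{\pi^2}{k^3}+O(k^{-4}),\qquad \xi_k=\frac14+\frac{3\pi^2}{4k^2}+O(k^{-3}).$$ Furthermore, $$x_c(s)=\frac14+\frac{3\pi^{2/3}}{4}(1-s)^{2/3}+o\bigl((1-s)^{2/3}\bigr),\qquad s\uparrow1.$$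
   Context: A Dyck path is a lattice path starting at $(0,0)$, with steps $U=(1,1)$ and $D=(1,-1)$, ending on the line $y=0$ and never visiting a vertex with negative $y$-coordinate; $\mathcal D$ is the set of all Dyck paths (including the empty path). For $\pi\in\mathcal D$ with $2n$ steps, $n(\pi)=n$ is the semi-length; the height $h(\pi)$ is the maximum $y$-coordinate; the proper area $a(\pi)$ is the sum of the starting heights of all steps. Water capacity $w(\pi)$: let $h=h(\pi)$. For each $1\le k\le h$ mark the first up-step $U_k$ of $\pi$ from level $k-1$ to $k$ and the last down-step $D_k$ from level $k$ to $k-1$; they occur in the order $U_1,\dots,U_h,D_h,\dots,D_1$. The portions of $\pi$ strictly between consecutive marked steps are the gaps: for $1\le k<h$ a left gap at level $k$ (between $U_k$ and $U_{k+1}$) and a right gap at level $k$ (between $D_{k+1}$ and $D_k$), and a single top gap at level $h$ (between $U_h$ and $D_h$). A gap at level $k$ starts and ends at height $k$ and never rises above height $k$; reflecting it in the line $y=k$ and translating to the horizontal axis gives a Dyck path of height at most $k$. Then $w(\pi)$ is the sum over all gaps of the proper areas of these reflected Dyck paths (and $w=0$ for the empty path). The sum $a(\pi)+w(\pi)$ is called the hull area. *)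

(* Defs.v *)
From Stdlib Require Import Reals ZArith List Bool FinFun Lia.
From Coquelicot Require Import Coquelicot.
Import ListNotations.

Inductive step : Set := U | D.

Definition path : Set := list step.

Definition rise (e : step) : Z := match e with U => 1 | D => -1 end.

Definition flip (e : step) : step := match e with U => D | D => U end.

Definition sumZ (l : list Z) : Z := fold_right Z.add 0%Z l.

(** [ordinate p i] is the y-coordinate of the [i]-th vertex of [p]: vertex [0]
    is the origin, and step [i] (counted from 0) goes from vertex [i] to
    vertex [S i]. *)
Definition ordinate (p : path) (i : nat) : Z := sumZ (map rise (firstn i p)).

Definition is_dyck (p : path) : bool :=
  (ordinate p (length p) =? 0)%Z
  && forallb (fun i => (0 <=? ordinate p i)%Z) (seq 0 (S (length p))).

Fixpoint words (m : nat) : list path :=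
  match m with
  | O => [[]]
  | S m' => map (cons U) (words m') ++ map (cons D) (words m')
  end.

(** The Dyck paths of semi-length [n], each listed once; see
    [in_dyck_paths] and [NoDup_dyck_paths]. *)
Definition dyck_paths (n : nat) : list path := filter is_dyck (words (2 * n)).

Definition height (p : path) : nat :=
  list_max (map (fun i => Z.to_nat (ordinate p i)) (seq 0 (S (length p)))).

Definition area (p : path) : Z := sumZ (map (ordinate p) (seq 0 (length p))).

Definition goes (p : path) (a b : nat) (i : nat) : bool :=
  (ordinate p i =? Z.of_nat a)%Z && (ordinate p (S i) =? Z.of_nat b)%Z.

(** Index of the marked step [U_k].  The default value of the search is
    irrelevant: for a Dyck path [p] and [1 <= k <= height p] the step exists.
    The same holds for [last_down]. *)
Definition first_up (p : path) (k : nat) : nat :=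
  match find (goes p (k - 1) k) (seq 0 (length p)) with
  | Some i => i
  | None => length p
  end.

Definition last_down (p : path) (k : nat) : nat :=
  match find (goes p k (k - 1)) (rev (seq 0 (length p))) with
  | Some i => i
  | None => length p
  end.

(** The steps with indices strictly between [i] and [j]. *)
Definition between (p : path) (i j : nat) : path :=
  firstn (j - S i) (skipn (S i) p).

Definition left_gap (p : path) (k : nat) : path :=
  between p (first_up p k) (first_up p (S k)).

Definition right_gap (p : path) (k : nat) : path :=
  between p (last_down p (S k)) (last_down p k).

Definition top_gap (p : path) : path :=
  between p (first_up p (height p)) (last_down p (height p)).

(** Lists of steps carry no starting point, so reflecting a gap and moving it
    to the horizontal axis amounts to exchanging [U] and [D]. *)
Definition reflected (g : path) : path := map flip g.

Definition water (p : path) : Z :=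
  match height p with
  | O => 0%Z
  | S _ =>
      (sumZ (map (fun k => area (reflected (left_gap p k))
                           + area (reflected (right_gap p k)))
                 (seq 1 (height p - 1)))
       + area (reflected (top_gap p)))%Z
  end.

Open Scope R_scope.

(** Coefficient of [x ^ n] in [G(x,1,s,s)], the sum of
    [x ^ n(p) * s ^ (a(p) + w(p))] over all Dyck paths [p]. *)
Definition hull_coeff (s : R) (n : nat) : R :=
  fold_right Rplus 0
    (map (fun p => powerRZ s (area p + water p)) (dyck_paths n)).

Definition x_c (s : R) : Rbar := CV_radius (hull_coeff s).

Definition x_ (k : nat) (s : R) : R :=
  1 / (4 * s ^ (2 * k) * cos (PI / INR (k + 2)) ^ 2).

Definition s_ (k : nat) : R :=
  cos (PI / INR (k + 2)) / cos (PI / INR (k + 3)).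

Definition xi_ (k : nat) : R := x_ k (s_ k).

Definition bigO_seq (u v : nat -> R) : Prop :=
  exists C : R, eventually (fun k => Rabs (u k) <= C * Rabs (v k)).

Lemma in_words (m : nat) (p : path) : In p (words m) <-> length p = m.
Proof.
revert p; induction m as [|m IH]; intros p; simpl.
- destruct p; simpl; split; intros H; try (now left); try easy.
  now destruct H.
- rewrite in_app_iff, !in_map_iff; split.
  + intros [[q [<- H]] | [q [<- H]]]; simpl; f_equal; now apply IH.
  + destruct p as [|[] p]; simpl; intros H; try easy; injection H as H;
      [left | right]; exists p; split; auto; now apply IH.
Qed.

Lemma NoDup_words (m : nat) : NoDup (words m).
Proof.
induction m as [|m IH]; simpl.
- constructor; [easy | constructor].
- apply NoDup_app.
  + apply Injective_map_NoDup; [intros a b H; now injection H | easy].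
  + apply Injective_map_NoDup; [intros a b H; now injection H | easy].
  + intros q; rewrite !in_map_iff; intros [a [<- _]] [b [H _]]; discriminate.
Qed.

Lemma in_dyck_paths (n : nat) (p : path) :
  In p (dyck_paths n) <->
  length p = (2 * n)%nat
  /\ ordinate p (length p) = 0%Z
  /\ (forall i, (i <= length p)%nat -> (0 <= ordinate p i)%Z).
Proof.
unfold dyck_paths, is_dyck.
rewrite filter_In, in_words, andb_true_iff, Z.eqb_eq, forallb_forall.
split; intros [H1 [H2 H3]]; repeat split; auto.
- intros i Hi; apply Z.leb_le, H3, in_seq; lia.
- intros i Hi; apply in_seq in Hi; apply Z.leb_le, H3; lia.
Qed.

Lemma NoDup_dyck_paths (n : nat) : NoDup (dyck_paths n).
Proof. apply NoDup_filter, NoDup_words. Qed.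

(* Main.v *)
(** Each step of a Dyck path contributes to the hull area the minimum of the
    running maximum before it and of the maximum after it: in a gap at level
    [k], a step starting at ordinate [y] counts [y] in the area and [k - y] in
    the water capacity.

    Paths confined to ordinates [0, ..., k] have hull area at most [2 n k], and
    their number grows like [lam k ^ (2 n)] with [lam k = 2 cos (PI / (k + 2))],
    so [x_c <= x_k].  Conversely, cutting a path at its first maximum and
    reversing the right part bounds the coefficients by products of sums over
    walks weighted by their running maximum.  If [r < x_k] for all [k], every
    level is subcritical for [q = sqrt r], the factors [s ^ k] tame the high
    levels, and a supersolution glued from the Perron vectors of the strips
    bounds these sums by a constant times [q ^ (- m)].

    The asymptotics use [1 + 2 k (1 - s) <= s ^ (- 2 k) <= 1 / (1 - 2 k (1 - s))]
    and [1 + t ^ 2 <= 1 / cos t ^ 2 <= 1 / (1 - t ^ 2)]. *)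

From Stdlib Require Import Reals ZArith List Bool Lia Lra Permutation FinFun.
From Coquelicot Require Import Coquelicot.
Require Import Defs.
Import ListNotations.

(** * The hull of a Dyck path *)

Open Scope Z_scope.

(** The hull at a step depends on both its past and its future, so no first-step recursion can
    follow it. Cutting at a maximum leaves two walks in which only the past matters, with state
    (running maximum, ordinate). On these states the transfer operator is block triangular: the
    block of level M is the strip of ordinates up to M scaled by s^M, with spectral radius s^M lam
    M, and its only exit is the step from its top corner to the top corner of level M + 1.
    Infinitely many subcritical blocks need not be jointly subcritical. The level weights g of the
    supersolution settle this: each leak is paid for by the slack 1 - theta of its block, and since
    s^M tends to 0 only finitely many levels need a weight other than 1. Cutting costs a factor 2n +
    1 for the position of the cut, which does not affect the radius. Since x marks pairs of steps,
    the variable per step is sqrt x and growth rates enter x_k squared. In the limit s to 1 the best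
    k balances the price 2k(1 - s) of a high level against the confinement cost PI^2 / k^2. *)

Lemma ordinate_0 (p : path) : ordinate p 0 = 0.
Proof. reflexivity. Qed.

Lemma ordinate_cons (e : step) (p : path) (i : nat) :
  ordinate (e :: p) (S i) = rise e + ordinate p i.
Proof. reflexivity. Qed.

Lemma ordinate_succ (p : path) (i : nat) :
  (i < length p)%nat ->
  ordinate p (S i) = ordinate p i + 1 \/ ordinate p (S i) = ordinate p i - 1.
Proof.
revert i; induction p as [|e p IH]; intros i Hi; simpl in Hi; [lia|].
destruct i as [|i].
- rewrite ordinate_cons, !ordinate_0; destruct e; simpl; lia.
- rewrite !(ordinate_cons e p); specialize (IH i ltac:(lia)); lia.
Qed.

Lemma ordinate_flip (p : path) (i : nat) :
  ordinate (map flip p) i = - ordinate p i.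
Proof.
revert i; induction p as [|e p IH]; intros [|i]; try reflexivity.
simpl map; rewrite !ordinate_cons, IH; destruct e; simpl rise; lia.
Qed.

Lemma ordinate_skipn (p : path) (a i : nat) :
  ordinate (skipn a p) i = ordinate p (a + i) - ordinate p a.
Proof.
revert a i; induction p as [|e p IH]; intros a i.
- rewrite skipn_nil; unfold ordinate; rewrite !firstn_nil; reflexivity.
- destruct a as [|a]; simpl skipn; simpl Nat.add.
  + rewrite ordinate_0; lia.
  + rewrite !ordinate_cons, IH; lia.
Qed.

Lemma ordinate_firstn (p : path) (a i : nat) :
  (i <= a)%nat -> ordinate (firstn a p) i = ordinate p i.
Proof. intros H; unfold ordinate; now rewrite firstn_firstn, Nat.min_l. Qed.

Lemma ordinate_app (p q : path) (i : nat) :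
  (i <= length p)%nat -> ordinate (p ++ q) i = ordinate p i.
Proof.
intros H; unfold ordinate; rewrite firstn_app.
replace (i - length p)%nat with 0%nat by lia; now rewrite firstn_O, app_nil_r.
Qed.

Lemma ordinate_end_app (p : path) (e : step) :
  ordinate (p ++ [e]) (S (length p)) = ordinate p (length p) + rise e.
Proof.
induction p as [|a p IH]; simpl length; simpl app.
- destruct e; reflexivity.
- rewrite !ordinate_cons, IH; lia.
Qed.

Lemma sumZ_app (l m : list Z) : sumZ (l ++ m) = sumZ l + sumZ m.
Proof. induction l; simpl; lia. Qed.

Lemma sumZ_seq_split (F : nat -> Z) (a m n : nat) :
  sumZ (map F (seq a (m + n))) =
  sumZ (map F (seq a m)) + sumZ (map F (seq (a + m) n)).
Proof. now rewrite seq_app, map_app, sumZ_app. Qed.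

Lemma sumZ_seq_succ (F : nat -> Z) (a m : nat) :
  sumZ (map F (seq a (S m))) = sumZ (map F (seq a m)) + F (a + m)%nat.
Proof. rewrite seq_S, map_app, sumZ_app; simpl; lia. Qed.

Lemma sumZ_seq_ext (F G : nat -> Z) (a m : nat) :
  (forall i, (a <= i < a + m)%nat -> F i = G i) ->
  sumZ (map F (seq a m)) = sumZ (map G (seq a m)).
Proof.
intros H; f_equal; apply map_ext_in; intros i Hi; apply in_seq in Hi; auto.
Qed.

Lemma sumZ_seq_le (F G : nat -> Z) (a m : nat) :
  (forall i, (a <= i < a + m)%nat -> F i <= G i) ->
  sumZ (map F (seq a m)) <= sumZ (map G (seq a m)).
Proof.
induction m as [|m IH]; intros H; [simpl; lia|].
rewrite !sumZ_seq_succ.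
specialize (IH ltac:(intros; apply H; lia)); specialize (H (a + m)%nat ltac:(lia)); lia.
Qed.

Lemma sumZ_seq_add (F G : nat -> Z) (a m : nat) :
  sumZ (map (fun i => F i + G i) (seq a m)) =
  sumZ (map F (seq a m)) + sumZ (map G (seq a m)).
Proof. induction m as [|m IH]; [easy|]; rewrite !sumZ_seq_succ; lia. Qed.

Lemma sumZ_seq_const (c : Z) (a m : nat) :
  sumZ (map (fun _ => c) (seq a m)) = c * Z.of_nat m.
Proof. induction m as [|m IH]; [simpl; lia|]; rewrite sumZ_seq_succ; lia. Qed.

Lemma sumZ_seq_shift (F : nat -> Z) (b a m : nat) :
  sumZ (map (fun i => F (b + i)%nat) (seq a m)) = sumZ (map F (seq (b + a) m)).
Proof.
induction m as [|m IH]; [easy|]; rewrite !sumZ_seq_succ, IH.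
now rewrite Nat.add_assoc.
Qed.

Lemma area_reflected_between (p : path) (i j : nat) :
  (i < j <= length p)%nat ->
  area (reflected (between p i j)) =
  sumZ (map (fun t => ordinate p (S i) - ordinate p t) (seq (S i) (j - S i))).
Proof.
intros H; unfold area, reflected, between.
rewrite length_map, length_firstn, length_skipn, Nat.min_l by lia.
replace (seq (S i) (j - S i)) with (seq (S i + 0) (j - S i)) by (f_equal; lia).
rewrite <- sumZ_seq_shift.
apply sumZ_seq_ext; intros t Ht.
rewrite ordinate_flip, ordinate_firstn, ordinate_skipn by lia; lia.
Qed.

Lemma find_seq_some (f : nat -> bool) (a m i : nat) :
  find f (seq a m) = Some i ->
  (a <= i < a + m)%nat /\ f i = true
  /\ forall j, (a <= j < i)%nat -> f j = false.
Proof.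
revert a; induction m as [|m IH]; intros a; simpl; [easy|].
destruct (f a) eqn:E.
- intros H; injection H as <-; repeat split; try lia; auto.
- intros H; destruct (IH _ H) as [H1 [H2 H3]]; repeat split; try lia; auto.
  intros j Hj; destruct (Nat.eq_dec j a) as [->|]; auto; apply H3; lia.
Qed.

Lemma find_rev_seq_some (f : nat -> bool) (m i : nat) :
  find f (rev (seq 0 m)) = Some i ->
  (i < m)%nat /\ f i = true /\ forall j, (i < j < m)%nat -> f j = false.
Proof.
induction m as [|m IH]; [easy|].
rewrite seq_S, rev_app_distr; simpl.
destruct (f m) eqn:E.
- intros H; injection H as <-; repeat split; try lia; auto.
- intros H; destruct (IH H) as [H1 [H2 H3]]; repeat split; try lia; auto.
  intros j Hj; destruct (Nat.eq_dec j m) as [->|]; auto; apply H3; lia.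
Qed.

Lemma goes_spec (p : path) (a b i : nat) :
  goes p a b i = true <->
  ordinate p i = Z.of_nat a /\ ordinate p (S i) = Z.of_nat b.
Proof. unfold goes; now rewrite andb_true_iff, !Z.eqb_eq. Qed.

Lemma goes_false (p : path) (a b i : nat) :
  goes p a b i = false <->
  ~ (ordinate p i = Z.of_nat a /\ ordinate p (S i) = Z.of_nat b).
Proof. rewrite <- goes_spec; destruct (goes p a b i); intuition congruence. Qed.

Definition dyck (p : path) : Prop :=
  ordinate p (length p) = 0
  /\ forall i, (i <= length p)%nat -> 0 <= ordinate p i.

Lemma list_max_ge (l : list nat) (x : nat) : In x l -> (x <= list_max l)%nat.
Proof.
intros H; pose proof (proj1 (list_max_le l (list_max l)) (le_n _)) as HF.
rewrite Forall_forall in HF; auto.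
Qed.

Lemma list_max_in (l : list nat) : l <> [] -> In (list_max l) l.
Proof.
induction l as [|a l IH]; [easy|]; intros _; simpl.
destruct l as [|b l]; [left; simpl; lia|].
specialize (IH ltac:(easy)).
destruct (Nat.max_spec a (list_max (b :: l))) as [[_ E]|[_ E]]; simpl in *; rewrite E; auto.
Qed.

Definition max_on (p : path) (a m : nat) : nat :=
  list_max (map (fun i => Z.to_nat (ordinate p i)) (seq a m)).

Lemma max_on_ge (p : path) (a m i : nat) :
  (a <= i < a + m)%nat -> ordinate p i <= Z.of_nat (max_on p a m).
Proof.
intros H.
assert (Z.to_nat (ordinate p i) <= max_on p a m)%nat; [|lia].
apply list_max_ge, (in_map (fun i => Z.to_nat (ordinate p i))), in_seq; lia.
Qed.

Lemma max_on_le (p : path) (a m k : nat) :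
  (forall i, (a <= i < a + m)%nat -> ordinate p i <= Z.of_nat k) ->
  (max_on p a m <= k)%nat.
Proof.
intros H; apply list_max_le, Forall_forall; intros x Hx.
apply in_map_iff in Hx as [i [<- Hi]]; apply in_seq in Hi.
specialize (H i Hi); lia.
Qed.

Lemma max_on_eq (p : path) (a m k i : nat) :
  (forall i, (a <= i < a + m)%nat -> ordinate p i <= Z.of_nat k) ->
  (a <= i < a + m)%nat -> ordinate p i = Z.of_nat k -> max_on p a m = k.
Proof.
intros H1 H2 H3; pose proof (max_on_ge p a m i H2); pose proof (max_on_le p a m k H1).
lia.
Qed.

Lemma ordinate_le_height (p : path) (i : nat) :
  (i <= length p)%nat -> ordinate p i <= Z.of_nat (height p).
Proof. intros H; apply (max_on_ge p 0 (S (length p))); lia. Qed.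

Lemma height_attained (p : path) :
  exists i, (i <= length p)%nat /\ Z.to_nat (ordinate p i) = height p.
Proof.
assert (H : In (height p) (map (fun i => Z.to_nat (ordinate p i)) (seq 0 (S (length p)))))
  by (apply list_max_in; easy).
apply in_map_iff in H as [i [H1 H2]]; apply in_seq in H2.
exists i; split; [lia | easy].
Qed.

(** Ordinates change by one, so a path that has not yet stepped from [k - 1] to [k] is still below
    [k]. This invariant ([low]) shows both that the search succeeds, because the height is attained,
    and that everything up to the marked step lies below [k]. *)
Lemma first_up_spec (p : path) (k : nat) :
  (1 <= k <= height p)%nat ->
  (first_up p k < length p)%nat
  /\ ordinate p (first_up p k) = Z.of_nat k - 1
  /\ ordinate p (S (first_up p k)) = Z.of_nat k
  /\ forall j, (j <= first_up p k)%nat -> ordinate p j < Z.of_nat k.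
Proof.
intros Hk; unfold first_up.
assert (low : forall m, (m <= length p)%nat ->
  (forall j, (j < m)%nat -> goes p (k - 1) k j = false) ->
  forall j, (j <= m)%nat -> ordinate p j < Z.of_nat k).
{ intros m Hm Hg j; induction j as [|j IH]; intros Hj; [rewrite ordinate_0; lia|].
  specialize (IH ltac:(lia)); specialize (Hg j ltac:(lia)).
  apply goes_false in Hg; destruct (ordinate_succ p j ltac:(lia)); lia. }
destruct (find _ _) as [i|] eqn:E.
- apply find_seq_some in E as [H1 [H2 H3]]; apply goes_spec in H2.
  repeat split; try lia; intros j Hj; apply (low i); try lia.
  intros j' Hj'; apply H3; lia.
- exfalso; destruct (height_attained p) as [i [H1 H2]].
  enough (ordinate p i < Z.of_nat k) by lia.
  apply (low (length p)); auto; intros j Hj.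
  apply (find_none _ _ E), in_seq; lia.
Qed.

(** The argument for the first up-step, run backwards: [d] counts vertices from the end, where the
    ordinate is 0 and hence below [k]. *)
Lemma last_down_spec (p : path) (k : nat) :
  dyck p -> (1 <= k <= height p)%nat ->
  (last_down p k < length p)%nat
  /\ ordinate p (last_down p k) = Z.of_nat k
  /\ ordinate p (S (last_down p k)) = Z.of_nat k - 1
  /\ forall j, (last_down p k < j <= length p)%nat -> ordinate p j < Z.of_nat k.
Proof.
intros [Hend _] Hk; unfold last_down.
assert (low : forall m,
  (forall j, (m <= j < length p)%nat -> goes p k (k - 1) j = false) ->
  forall d, (m + d <= length p)%nat -> ordinate p (length p - d) < Z.of_nat k).
{ intros m Hg d; induction d as [|d IH]; intros Hd; [rewrite Nat.sub_0_r; lia|].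
  specialize (IH ltac:(lia)).
  specialize (Hg (length p - S d)%nat ltac:(lia)); apply goes_false in Hg.
  replace (S (length p - S d)) with (length p - d)%nat in Hg by lia.
  pose proof (ordinate_succ p (length p - S d) ltac:(lia)) as Hs.
  replace (S (length p - S d)) with (length p - d)%nat in Hs by lia.
  lia. }
destruct (find _ _) as [i|] eqn:E.
- apply find_rev_seq_some in E as [H1 [H2 H3]]; apply goes_spec in H2.
  repeat split; try lia; intros j Hj.
  replace j with (length p - (length p - j))%nat by lia.
  apply (low (S i)); try lia.
  intros j' Hj'; apply H3; lia.
- exfalso; destruct (height_attained p) as [i [H1 H2]].
  enough (ordinate p i < Z.of_nat k) by lia.
  replace i with (length p - (length p - i))%nat by lia.
  apply (low 0%nat); try lia; intros j Hj.
  apply (find_none _ _ E); rewrite <- in_rev; apply in_seq; lia.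
Qed.

Definition hull (p : path) (t : nat) : nat :=
  Nat.min (max_on p 0 (S t)) (max_on p t (S (length p) - t)).

(** The range of [t] covers the left gap and also the start of the marked step to level [k + 1].
    That step lies in no gap, but it starts at ordinate [k], so its hull value is [k] as well. *)
Lemma hull_left (p : path) (k t : nat) :
  (1 <= k < height p)%nat -> (first_up p k < t <= first_up p (S k))%nat ->
  hull p t = k.
Proof.
intros Hk Ht.
destruct (first_up_spec p k ltac:(lia)) as [a1 [a2 [a3 a4]]].
destruct (first_up_spec p (S k) ltac:(lia)) as [b1 [b2 [b3 b4]]].
unfold hull; rewrite (max_on_eq p 0 (S t) k (S (first_up p k))); try lia.
- apply Nat.min_l.
  pose proof (max_on_ge p t (S (length p) - t) (S (first_up p (S k))) ltac:(lia)); lia.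
- intros i Hi; specialize (b4 i ltac:(lia)); lia.
Qed.

Lemma max_on_past_height (p : path) (t : nat) :
  (1 <= height p)%nat -> (first_up p (height p) < t <= length p)%nat ->
  max_on p 0 (S t) = height p.
Proof.
intros Hh Ht.
destruct (first_up_spec p (height p) ltac:(lia)) as [a1 [a2 [a3 a4]]].
apply (max_on_eq p 0 (S t) _ (S (first_up p (height p)))); try lia.
intros i Hi; apply ordinate_le_height; lia.
Qed.

Lemma first_up_lt_last_down (p : path) :
  dyck p -> (1 <= height p)%nat ->
  (first_up p (height p) < last_down p (height p))%nat.
Proof.
intros Hp Hh.
destruct (first_up_spec p (height p) ltac:(lia)) as [a1 [a2 [a3 a4]]].
destruct (last_down_spec p (height p) Hp ltac:(lia)) as [b1 [b2 [b3 b4]]].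
destruct (Nat.lt_ge_cases (first_up p (height p)) (last_down p (height p))) as [H|H]; auto.
specialize (a4 _ H); lia.
Qed.

Lemma last_down_succ_lt (p : path) (k : nat) :
  dyck p -> (1 <= k < height p)%nat -> (last_down p (S k) < last_down p k)%nat.
Proof.
intros Hp Hk.
destruct (last_down_spec p k Hp ltac:(lia)) as [a1 [a2 [a3 a4]]].
destruct (last_down_spec p (S k) Hp ltac:(lia)) as [b1 [b2 [b3 b4]]].
destruct (Nat.lt_ge_cases (last_down p (S k)) (last_down p k)) as [H|H]; auto.
destruct (Nat.eq_dec (last_down p (S k)) (last_down p k)) as [E|E].
- rewrite E in b2; lia.
- specialize (a4 (last_down p (S k)) ltac:(lia)); lia.
Qed.

Lemma first_up_lt_succ (p : path) (k : nat) :
  (1 <= k < height p)%nat -> (first_up p k < first_up p (S k))%nat.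
Proof.
intros Hk.
destruct (first_up_spec p k ltac:(lia)) as [a1 [a2 [a3 a4]]].
destruct (first_up_spec p (S k) ltac:(lia)) as [b1 [b2 [b3 b4]]].
destruct (Nat.lt_ge_cases (first_up p k) (first_up p (S k))) as [H|H]; auto.
specialize (a4 _ H); lia.
Qed.

Lemma height_last_down_le (p : path) (k : nat) :
  dyck p -> (1 <= k <= height p)%nat ->
  (last_down p (height p) <= last_down p k)%nat.
Proof.
intros Hp Hk.
destruct (last_down_spec p k Hp ltac:(lia)) as [a1 [a2 [a3 a4]]].
destruct (last_down_spec p (height p) Hp ltac:(lia)) as [b1 [b2 [b3 b4]]].
destruct (Nat.le_gt_cases (last_down p (height p)) (last_down p k)) as [H|H]; auto.
specialize (a4 (last_down p (height p)) ltac:(lia)); lia.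
Qed.

Lemma hull_top (p : path) (t : nat) :
  dyck p -> (1 <= height p)%nat ->
  (first_up p (height p) < t <= last_down p (height p))%nat ->
  hull p t = height p.
Proof.
intros Hp Hh Ht.
destruct (last_down_spec p (height p) Hp ltac:(lia)) as [b1 [b2 [b3 b4]]].
unfold hull; rewrite max_on_past_height by lia.
rewrite (max_on_eq p t (S (length p) - t) (height p) (last_down p (height p))); try lia.
intros i Hi; apply ordinate_le_height; lia.
Qed.

(** As on the left, the range ends with the start of a marked step, here the last step down from
    [k]. *)
Lemma hull_right (p : path) (k t : nat) :
  dyck p -> (1 <= k < height p)%nat ->
  (last_down p (S k) < t <= last_down p k)%nat -> hull p t = k.
Proof.
intros Hp Hk Ht.
destruct (last_down_spec p k Hp ltac:(lia)) as [a1 [a2 [a3 a4]]].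
destruct (last_down_spec p (S k) Hp ltac:(lia)) as [b1 [b2 [b3 b4]]].
pose proof (height_last_down_le p (S k) Hp ltac:(lia)).
pose proof (first_up_lt_last_down p Hp ltac:(lia)).
unfold hull; rewrite max_on_past_height by lia.
rewrite (max_on_eq p t (S (length p) - t) k (last_down p k)); try lia.
intros i Hi; specialize (b4 i ltac:(lia)); lia.
Qed.

(** Passing from [k] to [k + 1] adds the left gap at level [k], where the hull [k] splits as
    ordinate plus depth, and one marked step, whose hull equals its ordinate. *)
Lemma hull_left_sum (p : path) (k : nat) :
  dyck p -> (1 <= k <= height p)%nat ->
  sumZ (map (fun t => Z.of_nat (hull p t)) (seq 0 (S (first_up p k)))) =
  sumZ (map (ordinate p) (seq 0 (S (first_up p k))))
  + sumZ (map (fun j => area (reflected (left_gap p j))) (seq 1 (k - 1))).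
Proof.
intros Hp; induction k as [|k IH]; intros Hk; [lia|].
destruct (Nat.eq_dec k 0) as [->|Hk0].
- simpl (seq 1 _); simpl (sumZ (map _ [])); rewrite Z.add_0_r.
  destruct (first_up_spec p 1 ltac:(lia)) as [a1 [a2 [a3 a4]]].
  apply sumZ_seq_ext; intros i Hi; destruct Hp as [_ Hp].
  pose proof (a4 i ltac:(lia)); specialize (Hp i ltac:(lia)).
  assert (max_on p 0 (S i) <= 0)%nat; [|unfold hull; lia].
  apply max_on_le; intros j Hj; specialize (a4 j ltac:(lia)); lia.
- specialize (IH ltac:(lia)).
  destruct (first_up_spec p k ltac:(lia)) as [a1 [a2 [a3 a4]]].
  destruct (first_up_spec p (S k) ltac:(lia)) as [b1 [b2 [b3 b4]]].
  pose proof (first_up_lt_succ p k ltac:(lia)) as Hlt.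
  replace (S k - 1)%nat with (S (k - 1)) by lia.
  rewrite (sumZ_seq_succ _ 1 (k - 1)); replace (1 + (k - 1))%nat with k by lia.
  unfold left_gap at 2; rewrite area_reflected_between by lia.
  replace (S (first_up p (S k)))
    with (S (first_up p k) + S (first_up p (S k) - S (first_up p k)))%nat by lia.
  rewrite !sumZ_seq_split, IH, !Nat.add_0_l, a3.
  set (f := S (first_up p k)) in *; set (d := (first_up p (S k) - f)%nat).
  rewrite !(sumZ_seq_succ _ f d).
  replace (f + d)%nat with (first_up p (S k)) by lia.
  rewrite (hull_left p k) by lia.
  enough (sumZ (map (fun t => Z.of_nat (hull p t)) (seq f d)) =
          sumZ (map (ordinate p) (seq f d))
          + sumZ (map (fun t => Z.of_nat k - ordinate p t) (seq f d))) by lia.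
  rewrite <- sumZ_seq_add; apply sumZ_seq_ext; intros i Hi.
  rewrite (hull_left p k) by lia; lia.
Qed.

Lemma hull_right_sum (p : path) (k : nat) :
  dyck p -> (1 <= k <= height p)%nat ->
  sumZ (map (fun t => Z.of_nat (hull p t))
          (seq (last_down p k) (length p - last_down p k))) =
  sumZ (map (ordinate p) (seq (last_down p k) (length p - last_down p k)))
  + sumZ (map (fun j => area (reflected (right_gap p j))) (seq 1 (k - 1))).
Proof.
intros Hp; induction k as [|k IH]; intros Hk; [lia|].
destruct (Nat.eq_dec k 0) as [->|Hk0].
- simpl (seq 1 _); simpl (sumZ (map _ [])); rewrite Z.add_0_r.
  destruct (last_down_spec p 1 Hp ltac:(lia)) as [a1 [a2 [a3 a4]]].
  pose proof (height_last_down_le p 1 Hp ltac:(lia)).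
  pose proof (first_up_lt_last_down p Hp ltac:(lia)).
  apply sumZ_seq_ext; intros i Hi; destruct Hp as [Hp1 Hp].
  unfold hull; rewrite max_on_past_height by lia.
  destruct (Nat.eq_dec i (last_down p 1)) as [->|Hne].
  + rewrite (max_on_eq p _ _ 1 (last_down p 1)); try lia.
    intros j Hj; destruct (Nat.eq_dec j (last_down p 1)) as [->|]; [lia|].
    specialize (a4 j ltac:(lia)); lia.
  + assert (max_on p i (S (length p) - i) <= 0)%nat.
    { apply max_on_le; intros j Hj; specialize (a4 j ltac:(lia)); lia. }
    specialize (Hp i ltac:(lia)); specialize (a4 i ltac:(lia)); lia.
- specialize (IH ltac:(lia)).
  destruct (last_down_spec p k Hp ltac:(lia)) as [a1 [a2 [a3 a4]]].
  destruct (last_down_spec p (S k) Hp ltac:(lia)) as [b1 [b2 [b3 b4]]].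
  pose proof (last_down_succ_lt p k Hp ltac:(lia)) as Hlt.
  replace (S k - 1)%nat with (S (k - 1)) by lia.
  rewrite (sumZ_seq_succ _ 1 (k - 1)); replace (1 + (k - 1))%nat with k by lia.
  unfold right_gap at 2; rewrite area_reflected_between by lia.
  set (g := last_down p (S k)) in *; set (e := last_down p k) in *.
  replace (length p - g)%nat with (1 + ((e - S g) + (length p - e)))%nat by lia.
  rewrite !sumZ_seq_split.
  replace (g + 1)%nat with (S g) by lia.
  replace (S g + (e - S g))%nat with e by lia.
  rewrite IH, b3.
  replace (Z.of_nat (S k) - 1) with (Z.of_nat k) by lia.
  (* The start of the marked step down from [k + 1] closes the top gap if [k + 1] is the height, and
     a right gap otherwise. *)
  assert (E : Z.of_nat (hull p g) = ordinate p g).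
  { rewrite b2; f_equal.
    destruct (Nat.eq_dec (S k) (height p)) as [Eh|Eh].
    - unfold g; rewrite Eh; apply hull_top; auto; try lia.
      split; [apply first_up_lt_last_down; auto; lia | lia].
    - apply hull_right; auto; try lia.
      split; [apply last_down_succ_lt; auto; lia | unfold g; lia]. }
  simpl (seq g 1); simpl (sumZ (map _ [g])); rewrite E.
  enough (sumZ (map (fun t => Z.of_nat (hull p t)) (seq (S g) (e - S g))) =
          sumZ (map (ordinate p) (seq (S g) (e - S g)))
          + sumZ (map (fun t => Z.of_nat k - ordinate p t) (seq (S g) (e - S g)))) by lia.
  rewrite <- sumZ_seq_add; apply sumZ_seq_ext; intros i Hi.
  rewrite (hull_right p k); auto; fold g; fold e; lia.
Qed.

(** The path is split into the part through the first step to its height, the top gap, and the part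
    from the last step down from its height. *)
Lemma hull_area (p : path) :
  dyck p ->
  area p + water p =
  sumZ (map (fun t => Z.of_nat (hull p t)) (seq 0 (length p))).
Proof.
intros Hp; unfold area, water.
destruct (height p) as [|h'] eqn:Eh.
- rewrite Z.add_0_r; apply sumZ_seq_ext; intros i Hi.
  pose proof (ordinate_le_height p i ltac:(lia)).
  assert (max_on p 0 (S i) <= 0)%nat; [|unfold hull; destruct Hp as [_ Hp];
    specialize (Hp i ltac:(lia)); lia].
  apply max_on_le; intros j Hj.
  pose proof (ordinate_le_height p j ltac:(lia)); lia.
- rewrite <- Eh.
  pose proof (hull_left_sum p (height p) Hp ltac:(lia)) as HL.
  pose proof (hull_right_sum p (height p) Hp ltac:(lia)) as HR.
  rewrite sumZ_seq_add.
  destruct (first_up_spec p (height p) ltac:(lia)) as [a1 [a2 [a3 a4]]].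
  destruct (last_down_spec p (height p) Hp ltac:(lia)) as [b1 [b2 [b3 b4]]].
  pose proof (first_up_lt_last_down p Hp ltac:(lia)) as Hlt.
  unfold top_gap; rewrite area_reflected_between, a3 by lia.
  set (f := first_up p (height p)) in *; set (d := last_down p (height p)) in *.
  replace (seq 0 (length p)) with (seq 0 (S f + ((d - S f) + (length p - d))))
    by (f_equal; lia).
  rewrite !sumZ_seq_split, !Nat.add_0_l.
  replace (S f + (d - S f))%nat with d by lia.
  rewrite HL, HR.
  enough (sumZ (map (fun t => Z.of_nat (hull p t)) (seq (S f) (d - S f))) =
          sumZ (map (ordinate p) (seq (S f) (d - S f)))
          + sumZ (map (fun t => Z.of_nat (height p) - ordinate p t) (seq (S f) (d - S f)))) by lia.
  rewrite <- sumZ_seq_add; apply sumZ_seq_ext; intros i Hi.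
  rewrite hull_top; auto; fold f; fold d; lia.
Qed.

Lemma hull_area_le (p : path) (k : nat) :
  dyck p -> (forall i, (i <= length p)%nat -> ordinate p i <= Z.of_nat k) ->
  area p + water p <= Z.of_nat (k * length p).
Proof.
intros Hp Hk; rewrite hull_area, Nat2Z.inj_mul, <- (sumZ_seq_const _ 0) by easy.
apply sumZ_seq_le; intros t Ht; unfold hull.
assert (max_on p 0 (S t) <= k)%nat; [|lia].
apply max_on_le; intros i Hi; apply Hk; lia.
Qed.

Close Scope Z_scope.
Open Scope R_scope.

(** * Sums over words and coefficient bounds *)

Definition lsum {T : Type} (l : list T) (F : T -> R) : R :=
  fold_right Rplus 0 (map F l).

Lemma lsum_app {T : Type} (l m : list T) (F : T -> R) :
  lsum (l ++ m) F = lsum l F + lsum m F.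
Proof. unfold lsum; induction l; simpl; lra. Qed.

Lemma lsum_map {S T : Type} (g : S -> T) (l : list S) (F : T -> R) :
  lsum (map g l) F = lsum l (fun x => F (g x)).
Proof. unfold lsum; now rewrite map_map. Qed.

Lemma lsum_le {T : Type} (l : list T) (F G : T -> R) :
  (forall x, In x l -> F x <= G x) -> lsum l F <= lsum l G.
Proof.
unfold lsum; induction l as [|a l IH]; simpl; intros H; [lra|].
apply Rplus_le_compat; auto.
Qed.

Lemma lsum_ext {T : Type} (l : list T) (F G : T -> R) :
  (forall x, In x l -> F x = G x) -> lsum l F = lsum l G.
Proof. intros H; unfold lsum; f_equal; now apply map_ext_in. Qed.

Lemma lsum_scal {T : Type} (c : R) (l : list T) (F : T -> R) :
  lsum l (fun x => c * F x) = c * lsum l F.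
Proof. unfold lsum; induction l; simpl; lra. Qed.

Lemma lsum_const {T : Type} (l : list T) (c : R) :
  lsum l (fun _ => c) = INR (length l) * c.
Proof.
unfold lsum; induction l; [simpl; lra|].
simpl length; rewrite S_INR; simpl; lra.
Qed.

Lemma lsum_add {T : Type} (l : list T) (F G : T -> R) :
  lsum l (fun x => F x + G x) = lsum l F + lsum l G.
Proof. unfold lsum; induction l; simpl; lra. Qed.

Lemma lsum_swap {S T : Type} (l : list S) (m : list T) (F : S -> T -> R) :
  lsum l (fun x => lsum m (F x)) = lsum m (fun y => lsum l (fun x => F x y)).
Proof.
induction l as [|a l IH].
- change (0 = lsum m (fun _ => 0)); rewrite lsum_const; lra.
- change (lsum m (F a) + lsum l (fun x => lsum m (F x)) =
          lsum m (fun y => F a y + lsum l (fun x => F x y))).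
  now rewrite lsum_add, IH.
Qed.

Lemma lsum_nonneg {T : Type} (l : list T) (F : T -> R) :
  (forall x, In x l -> 0 <= F x) -> 0 <= lsum l F.
Proof.
intros H; rewrite <- (Rmult_0_r (INR (length l))), <- lsum_const.
now apply lsum_le.
Qed.

Lemma lsum_ge_term {T : Type} (l : list T) (F : T -> R) (x : T) :
  (forall y, In y l -> 0 <= F y) -> In x l -> F x <= lsum l F.
Proof.
intros H Hx; apply in_split in Hx as [l1 [l2 ->]].
assert (Hn : forall m, incl m (l1 ++ x :: l2) -> 0 <= lsum m F)
  by (intros m Hm; apply lsum_nonneg; auto).
rewrite lsum_app; change (lsum (x :: l2) F) with (F x + lsum l2 F).
pose proof (Hn l1 ltac:(intros y; rewrite in_app_iff; auto)).
pose proof (Hn l2 ltac:(intros y; rewrite in_app_iff; simpl; auto)); lra.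
Qed.

Lemma lsum_permutation {T : Type} (l m : list T) (F : T -> R) :
  Permutation l m -> lsum l F = lsum m F.
Proof. unfold lsum; induction 1; simpl; lra. Qed.

Lemma lsum_filter {T : Type} (f : T -> bool) (l : list T) (F : T -> R) :
  lsum (filter f l) F = lsum l (fun x => if f x then F x else 0).
Proof.
unfold lsum; induction l as [|a l IH]; simpl; [easy|].
destruct (f a); simpl; rewrite IH; lra.
Qed.

Lemma lsum_words_succ (m : nat) (F : path -> R) :
  lsum (words (S m)) F =
  lsum (words m) (fun p => F (U :: p)) + lsum (words m) (fun p => F (D :: p)).
Proof. simpl words; now rewrite lsum_app, !lsum_map. Qed.

Lemma lsum_words_split (a b : nat) (F G : path -> R) :
  lsum (words (a + b)) (fun p => F (firstn a p) * G (skipn a p)) =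
  lsum (words a) F * lsum (words b) G.
Proof.
revert F; induction a as [|a IH]; intros F.
- simpl Nat.add; simpl skipn.
  rewrite (lsum_ext _ _ (fun p => F [] * G p)) by now intros.
  rewrite lsum_scal; unfold lsum; simpl; lra.
- simpl Nat.add; rewrite !lsum_words_succ; simpl firstn; simpl skipn.
  rewrite (IH (fun p => F (U :: p))), (IH (fun p => F (D :: p))); lra.
Qed.

(** The path read from right to left; each step then runs the other way, whence the flip. The right
    part of a Dyck path becomes a walk that starts on the axis. *)
Definition reversed (p : path) : path := rev (map flip p).

Lemma reversed_involutive (p : path) : reversed (reversed p) = p.
Proof.
unfold reversed; rewrite map_rev, rev_involutive, map_map.
rewrite <- (map_id p) at 2; apply map_ext; now intros [].
Qed.

Lemma length_reversed (p : path) : length (reversed p) = length p.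
Proof. unfold reversed; now rewrite length_rev, length_map. Qed.

Lemma lsum_words_reversed (m : nat) (F : path -> R) :
  lsum (words m) (fun p => F (reversed p)) = lsum (words m) F.
Proof.
rewrite <- (lsum_map reversed); apply lsum_permutation, NoDup_Permutation.
- apply Injective_map_NoDup, NoDup_words.
  intros p q H; rewrite <- (reversed_involutive p), H; apply reversed_involutive.
- apply NoDup_words.
- intros p; rewrite in_map_iff, in_words; split.
  + intros [q [<- Hq]]; apply in_words in Hq; now rewrite length_reversed.
  + intros H; exists (reversed p); rewrite in_words, length_reversed.
    now rewrite reversed_involutive.
Qed.

Lemma ordinate_reversed (p : path) (i : nat) :
  (i <= length p)%nat ->
  ordinate (reversed p) i = (ordinate p (length p - i) - ordinate p (length p))%Z.
Proof.
revert i; induction p as [|e p IH]; intros i Hi.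
- simpl in Hi; replace i with 0%nat by lia; reflexivity.
- simpl length in *; replace (reversed (e :: p)) with (reversed p ++ [flip e]) by reflexivity.
  destruct (Nat.eq_dec i (S (length p))) as [->|Hne].
  + rewrite <- (length_reversed p) at 1.
    rewrite ordinate_end_app, length_reversed, IH by lia.
    rewrite !Nat.sub_diag, ordinate_cons, !ordinate_0; destruct e; simpl rise; lia.
  + rewrite ordinate_app by (rewrite length_reversed; lia).
    rewrite IH by lia.
    replace (S (length p) - i)%nat with (S (length p - i)) by lia.
    rewrite !ordinate_cons; lia.
Qed.

(** Walks from ordinate [y] with running maximum [M] so far: each step weighs [s]
    to the power of the running maximum at its start. *)
Fixpoint run_weight (s : R) (M y : nat) (p : path) : R :=
  match p with
  | [] => 1
  | U :: p' => s ^ M * run_weight s (Nat.max M (S y)) (S y) p'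
  | D :: p' => match y with
               | O => 0
               | S y' => s ^ M * run_weight s M y' p'
               end
  end.

Lemma run_weight_nonneg (s : R) (M y : nat) (p : path) :
  0 < s -> 0 <= run_weight s M y p.
Proof.
intros Hs; revert M y; induction p as [|[] p IH]; intros M y; simpl; [lra| |].
- apply Rmult_le_pos; auto; apply pow_le; lra.
- destruct y; [lra|]; apply Rmult_le_pos; auto; apply pow_le; lra.
Qed.

Lemma pow_antitone (s : R) (m n : nat) :
  0 < s <= 1 -> (n <= m)%nat -> s ^ m <= s ^ n.
Proof.
intros Hs H; replace m with (n + (m - n))%nat by lia; rewrite pow_add.
pose proof (pow_lt s n ltac:(lra)).
pose proof (pow_incr s 1 (m - n) ltac:(lra)) as H1; rewrite pow1 in H1; nra.
Qed.

(** [H] dominates the running maximum at every step, and [s <= 1] reverses the order. An arbitrary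
    [H] allows the hull on the left part and the hull read backwards on the right part. Non-negative
    ordinates keep the walk off the zero branch. *)
Lemma run_weight_ge (s : R) (p : path) (M y : nat) (H : nat -> nat) :
  0 < s <= 1 ->
  (forall i, (i <= length p)%nat -> (0 <= Z.of_nat y + ordinate p i)%Z) ->
  (forall t, (t < length p)%nat -> (M <= H t)%nat) ->
  (forall i t, (i <= t < length p)%nat ->
     (Z.of_nat y + ordinate p i <= Z.of_nat (H t))%Z) ->
  s ^ list_sum (map H (seq 0 (length p))) <= run_weight s M y p.
Proof.
intros Hs; revert M y H; induction p as [|e p IH]; intros M y H H1 H2 H3.
- simpl; lra.
- simpl length in *.
  change (seq 0 (S (length p))) with (0%nat :: seq 1 (length p)).
  rewrite <- seq_shift, map_cons, map_map.
  change (list_sum (?a :: ?b)) with (a + list_sum b)%nat; rewrite pow_add.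
  assert (HM : s ^ H 0%nat <= s ^ M) by (apply pow_antitone; auto; apply H2; lia).
  assert (Hstep : forall M' y', Z.of_nat y' = (Z.of_nat y + rise e)%Z ->
     (forall t, (t < length p)%nat -> (M' <= H (S t))%nat) ->
     s ^ H 0%nat * s ^ list_sum (map (fun x => H (S x)) (seq 0 (length p)))
     <= s ^ M * run_weight s M' y' p).
  { intros M' y' Hy HM'.
    apply Rmult_le_compat; auto; try (apply pow_le; lra).
    apply (IH M' y' (fun x => H (S x))); auto.
    - intros i Hi; specialize (H1 (S i) ltac:(lia)); rewrite ordinate_cons in H1; lia.
    - intros i t Hit; specialize (H3 (S i) (S t) ltac:(lia)).
      rewrite ordinate_cons in H3; lia. }
  pose proof (H1 1%nat ltac:(lia)) as Hy; rewrite ordinate_cons, ordinate_0 in Hy.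
  destruct e; simpl rise in *; simpl run_weight.
  + apply Hstep; [lia|]; intros t Ht.
    pose proof (H2 (S t) ltac:(lia)).
    pose proof (H3 1%nat (S t) ltac:(lia)) as H4.
    rewrite ordinate_cons, ordinate_0 in H4; simpl rise in H4; lia.
  + destruct y as [|y']; [lia|].
    apply Hstep; [lia|]; intros t Ht; apply H2; lia.
Qed.

Lemma list_sum_rev (l : list nat) : list_sum (rev l) = list_sum l.
Proof.
induction l as [|a l IH]; [easy|]; simpl rev.
rewrite list_sum_app, IH; simpl; lia.
Qed.

Lemma sumZ_list_sum (l : list nat) : sumZ (map Z.of_nat l) = Z.of_nat (list_sum l).
Proof. induction l as [|a l IH]; [easy|]; simpl in *; lia. Qed.

Lemma map_seq_rev {T : Type} (f : nat -> T) (a m : nat) :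
  map f (seq a m) = rev (map (fun t => f (a + m - 1 - t)%nat) (seq 0 m)).
Proof.
revert a; induction m as [|m IH]; intros a; [easy|].
rewrite (seq_S m 0), map_app, rev_app_distr; simpl.
f_equal; [f_equal; lia|].
rewrite IH; f_equal; apply map_ext_in; intros t Ht; apply in_seq in Ht.
f_equal; lia.
Qed.

(* A Dyck path is cut just after the first step to its maximal height; on the
   left part the hull is the running maximum, on the reversed right part it
   dominates the running maximum. *)
Lemma hull_weight_le (s : R) (p : path) :
  0 < s <= 1 -> dyck p ->
  exists a, (a <= length p)%nat /\
    powerRZ s (area p + water p) <=
    run_weight s 0 0 (firstn a p) * run_weight s 0 0 (reversed (skipn a p)).
Proof.
intros Hs Hp.
(* A path of height 0 has no marked step, hence the separate value. *)
set (a := if (height p =? 0)%nat then 0%nat else S (first_up p (height p))).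
assert (Ha : (a <= length p)%nat).
{ unfold a; destruct (Nat.eqb_spec (height p) 0) as [E|E]; [lia|].
  destruct (first_up_spec p (height p) ltac:(lia)); lia. }
exists a; split; [easy|].
rewrite hull_area, <- map_map, sumZ_list_sum, <- pow_powerRZ by easy.
replace (length p) with (a + (length p - a))%nat by lia.
rewrite seq_app, map_app, list_sum_app, pow_add; simpl Nat.add.
pose proof (length_firstn a p) as L1; rewrite Nat.min_l in L1 by easy.
pose proof (length_skipn a p) as L2.
(* Before the cut the maximum of the path is still ahead, so the running maximum is the smaller of
   the two maxima in the hull. *)
assert (Hpast : forall t i, (t < a)%nat -> (i <= t)%nat ->
  (ordinate p i <= Z.of_nat (hull p t))%Z).
{ intros t i Ht Hi.
  pose proof (max_on_ge p 0 (S t) i ltac:(lia)).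
  enough (max_on p 0 (S t) <= max_on p t (S (length p) - t))%nat by (unfold hull; lia).
  unfold a in *; destruct (Nat.eqb_spec (height p) 0) as [E|E]; [lia|].
  destruct (first_up_spec p (height p) ltac:(lia)) as [b1 [b2 [b3 b4]]].
  pose proof (max_on_ge p t (S (length p) - t) (S (first_up p (height p))) ltac:(lia)).
  apply max_on_le; intros j Hj.
  pose proof (ordinate_le_height p j ltac:(lia)); lia. }
(* After the cut the maximum has been reached, so the hull is the maximum of what remains. *)
assert (Hfut : forall t i, (a <= t)%nat -> (t <= i <= length p)%nat ->
  (ordinate p i <= Z.of_nat (hull p t))%Z).
{ intros t i Ht Hi.
  pose proof (max_on_ge p t (S (length p) - t) i ltac:(lia)).
  pose proof (ordinate_le_height p i ltac:(lia)).
  enough (height p <= max_on p 0 (S t))%nat by (unfold hull; lia).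
  unfold a in *; destruct (Nat.eqb_spec (height p) 0) as [E|E]; [lia|].
  destruct (first_up_spec p (height p) ltac:(lia)) as [b1 [b2 [b3 b4]]].
  pose proof (max_on_ge p 0 (S t) (S (first_up p (height p))) ltac:(lia)); lia. }
destruct Hp as [Hp1 Hp2].
apply Rmult_le_compat; try (apply pow_le; lra).
- rewrite <- L1 at 1; apply run_weight_ge; auto.
  + intros i Hi; rewrite ordinate_firstn by lia; specialize (Hp2 i ltac:(lia)); lia.
  + intros t Ht; lia.
  + intros i t Hi; rewrite ordinate_firstn by lia.
    specialize (Hpast t i ltac:(lia) ltac:(lia)); lia.
- rewrite map_seq_rev, list_sum_rev, <- L2, <- length_reversed.
  pose proof (length_reversed (skipn a p)) as L3.
  assert (Hord : forall i, (i <= length p - a)%nat ->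
    ordinate (reversed (skipn a p)) i = ordinate p (length p - i)).
  { intros i Hi; rewrite ordinate_reversed by lia.
    rewrite !ordinate_skipn, L2.
    replace (a + (length p - a))%nat with (length p) by lia.
    replace (a + (length p - a - i))%nat with (length p - i)%nat by lia; lia. }
  apply run_weight_ge; auto.
  + intros i Hi; rewrite Hord by lia; specialize (Hp2 (length p - i)%nat ltac:(lia)); lia.
  + intros t Ht; lia.
  (* Step [t] of the reversed part is step [length p - 1 - t] of [p], traversed from its other end.
     The hull at that index sees one vertex more than the running maximum of the reversed walk, so
     it only dominates it. *)
  + intros i t Hi; rewrite Hord by lia.
    pose proof (Hfut (a + length (reversed (skipn a p)) - 1 - t)%nat
                  (length p - i)%nat ltac:(lia) ltac:(lia)) as H; exact H.
Qed.

Lemma is_dyck_spec (p : path) : is_dyck p = true <-> dyck p.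
Proof.
unfold is_dyck, dyck; rewrite andb_true_iff, Z.eqb_eq, forallb_forall.
split; intros [H1 H2]; split; auto.
- intros i Hi; apply Z.leb_le, H2, in_seq; lia.
- intros i Hi; apply in_seq in Hi; apply Z.leb_le, H2; lia.
Qed.

Lemma hull_coeff_eq (s : R) (n : nat) :
  hull_coeff s n =
  lsum (words (2 * n)) (fun p => if is_dyck p then powerRZ s (area p + water p) else 0).
Proof. unfold hull_coeff, dyck_paths; apply lsum_filter. Qed.

(** The cut position depends on the path. Summing over all positions, with non-negative terms,
    removes this dependence and makes the sum over words factor. *)
Lemma hull_coeff_le (s : R) (n : nat) :
  0 < s <= 1 ->
  hull_coeff s n <=
  lsum (seq 0 (S (2 * n))) (fun a =>
    lsum (words a) (run_weight s 0 0) * lsum (words (2 * n - a)) (run_weight s 0 0)).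
Proof.
intros Hs; rewrite hull_coeff_eq.
rewrite (lsum_ext (seq _ _) _ (fun a => lsum (words (2 * n)) (fun p =>
   run_weight s 0 0 (firstn a p) * run_weight s 0 0 (reversed (skipn a p))))).
- rewrite lsum_swap; apply lsum_le; intros p Hp; apply in_words in Hp.
  set (F := fun a : nat => run_weight s 0 0 (firstn a p)
                           * run_weight s 0 0 (reversed (skipn a p))).
  assert (H0 : forall a, 0 <= F a)
    by (intros a; apply Rmult_le_pos; apply run_weight_nonneg; lra).
  destruct (is_dyck p) eqn:E.
  + apply is_dyck_spec in E; destruct (hull_weight_le s p Hs E) as [a [H1 H2]].
    apply Rle_trans with (1 := H2).
    apply (lsum_ge_term _ F); auto; apply in_seq; lia.
  + apply Rle_trans with (1 := H0 0%nat).
    apply (lsum_ge_term _ F); auto; apply in_seq; lia.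
- intros a Ha; apply in_seq in Ha.
  replace (2 * n)%nat with (a + (2 * n - a))%nat at 2 by lia.
  now rewrite (lsum_words_split a _ _ (fun q => run_weight s 0 0 (reversed q))),
    lsum_words_reversed.
Qed.

(** * Walks confined to a strip, and the lower bound of the coefficients *)

Fixpoint in_strip (k y : nat) (p : path) : bool :=
  match p with
  | [] => (y =? 0)%nat
  | U :: p' => (y <? k)%nat && in_strip k (S y) p'
  | D :: p' => match y with O => false | S y' => in_strip k y' p' end
  end.

Lemma in_strip_spec (k y : nat) (p : path) :
  (y <= k)%nat -> in_strip k y p = true ->
  (Z.of_nat y + ordinate p (length p) = 0)%Z
  /\ forall i, (i <= length p)%nat ->
       (0 <= Z.of_nat y + ordinate p i <= Z.of_nat k)%Z.
Proof.
revert y; induction p as [|[] p IH]; intros y Hy; simpl in_strip.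
- rewrite Nat.eqb_eq; intros ->; split; [easy|].
  intros i Hi; simpl in Hi; replace i with 0%nat by lia; rewrite ordinate_0; lia.
- rewrite andb_true_iff, Nat.ltb_lt; intros [Hk H].
  destruct (IH (S y) ltac:(lia) H) as [H1 H2]; split.
  + simpl length; rewrite ordinate_cons; simpl rise; lia.
  + intros [|i] Hi; [rewrite ordinate_0; lia|]; simpl length in Hi.
    rewrite ordinate_cons; simpl rise; specialize (H2 i ltac:(lia)); lia.
- destruct y as [|y']; [easy|]; intros H.
  destruct (IH y' ltac:(lia) H) as [H1 H2]; split.
  + simpl length; rewrite ordinate_cons; simpl rise; lia.
  + intros [|i] Hi; [rewrite ordinate_0; lia|]; simpl length in Hi.
    rewrite ordinate_cons; simpl rise; specialize (H2 i ltac:(lia)); lia.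
Qed.

Definition strip_walks (k m y : nat) : R :=
  lsum (words m) (fun p => if in_strip k y p then 1 else 0).

Lemma hull_coeff_ge (s : R) (k n : nat) :
  0 < s <= 1 -> s ^ (k * (2 * n)) * strip_walks k (2 * n) 0 <= hull_coeff s n.
Proof.
intros Hs; unfold strip_walks; rewrite hull_coeff_eq, <- lsum_scal.
apply lsum_le; intros p Hp; apply in_words in Hp.
destruct (in_strip k 0 p) eqn:E.
- destruct (in_strip_spec k 0 p ltac:(lia) E) as [H1 H2].
  assert (Hd : dyck p) by (split; [lia|]; intros i Hi; specialize (H2 i Hi); lia).
  rewrite (proj2 (is_dyck_spec p) Hd), Rmult_1_r.
  assert (Hle : (area p + water p <= Z.of_nat (k * length p))%Z)
    by (apply hull_area_le; auto; intros i Hi; specialize (H2 i Hi); lia).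
  assert (H0 : (0 <= area p + water p)%Z).
  { rewrite hull_area, <- map_map, sumZ_list_sum by easy; lia. }
  rewrite <- (Z2Nat.id _ H0), <- pow_powerRZ.
  apply pow_antitone; auto; rewrite Hp in Hle; lia.
- rewrite Rmult_0_r; destruct (is_dyck p); [apply powerRZ_le|]; lra.
Qed.

Lemma hull_coeff_nonneg (s : R) (n : nat) : 0 < s -> 0 <= hull_coeff s n.
Proof.
intros Hs; rewrite hull_coeff_eq; apply lsum_nonneg; intros p _.
destruct (is_dyck p); [now apply powerRZ_le | apply Rle_refl].
Qed.

(** * Transfer matrices of the strips *)

Definition angle (k : nat) : R := PI / INR (k + 2).

(** The largest adjacency eigenvalue of the path graph on [k + 1] vertices. *)
Definition lam (k : nat) : R := 2 * cos (angle k).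

(** [(eigvec k 1, ..., eigvec k (k + 1))] is the Perron vector of the path graph
    on the ordinates [0, ..., k]. *)
Definition eigvec (k y : nat) : R := sin (INR y * angle k).

Lemma INR_pos (n : nat) : (0 < n)%nat -> 0 < INR n.
Proof. intros H; apply (lt_INR 0 n H). Qed.

Lemma angle_mult (k : nat) : INR (k + 2) * angle k = PI.
Proof. unfold angle; field; apply not_0_INR; lia. Qed.

Lemma angle_pos (k : nat) : 0 < angle k.
Proof. apply Rdiv_lt_0_compat; [apply PI_RGT_0 | apply INR_pos; lia]. Qed.

Lemma angle_le_PI2 (k : nat) : angle k <= PI / 2.
Proof.
pose proof (angle_mult k); pose proof (angle_pos k).
rewrite plus_INR in H; simpl in H; pose proof (pos_INR k); nra.
Qed.

Lemma angle_le_PI3 (k : nat) : (1 <= k)%nat -> angle k <= PI / 3.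
Proof.
intros Hk; pose proof (angle_mult k); pose proof (angle_pos k).
rewrite plus_INR in H; simpl in H; apply le_INR in Hk; simpl in Hk; nra.
Qed.

Lemma cos_angle_ge (k : nat) : (1 <= k)%nat -> 1 / 2 <= cos (angle k).
Proof.
intros Hk; rewrite <- cos_PI3; pose proof PI_RGT_0.
pose proof (angle_le_PI3 k Hk); pose proof (angle_pos k); apply cos_decr_1; lra.
Qed.

Lemma lam_nonneg (k : nat) : 0 <= lam k.
Proof.
unfold lam; pose proof (angle_pos k); pose proof (angle_le_PI2 k).
pose proof (cos_ge_0 (angle k) ltac:(lra) ltac:(lra)); lra.
Qed.

Lemma eigvec_rec (k y : nat) :
  eigvec k y + eigvec k (S (S y)) = lam k * eigvec k (S y).
Proof.
unfold eigvec, lam; rewrite Rplus_comm, form3, !S_INR.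
replace (((INR y + 1 + 1) * angle k - INR y * angle k) / 2) with (angle k) by field.
f_equal; f_equal; field.
Qed.

Lemma eigvec_0 (k : nat) : eigvec k 0 = 0.
Proof. unfold eigvec; simpl; now rewrite Rmult_0_l, sin_0. Qed.

Lemma eigvec_end (k : nat) : eigvec k (k + 2) = 0.
Proof. unfold eigvec; now rewrite angle_mult, sin_PI. Qed.

Lemma eigvec_sym (k y : nat) :
  (y <= k + 2)%nat -> eigvec k (k + 2 - y) = eigvec k y.
Proof.
intros H; unfold eigvec; rewrite minus_INR, Rmult_minus_distr_r, angle_mult by easy.
now rewrite sin_PI_x.
Qed.

Lemma eigvec_pos (k y : nat) : (1 <= y <= k + 1)%nat -> 0 < eigvec k y.
Proof.
intros H; pose proof (angle_pos k); pose proof (angle_mult k).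
pose proof (lt_INR y (k + 2) ltac:(lia)); pose proof (INR_pos y ltac:(lia)).
apply sin_gt_0; nra.
Qed.

(** The sine is symmetric on the interval from 0 to PI and increasing on its first half, so the end
    entries are the smallest. Dividing by them makes every entry at least 1 and the corner entries
    equal to 1. *)
Lemma eigvec_1_le (k y : nat) : (1 <= y <= k + 1)%nat -> eigvec k 1 <= eigvec k y.
Proof.
enough (Hlow : forall z, (1 <= z)%nat -> (2 * z <= k + 2)%nat -> eigvec k 1 <= eigvec k z).
{ intros H; destruct (Nat.le_gt_cases (2 * y) (k + 2)) as [Hy|Hy].
  - apply Hlow; lia.
  - rewrite <- (eigvec_sym k y) by lia; apply Hlow; lia. }
intros z H1 H2; pose proof (angle_pos k); pose proof (angle_mult k).
apply le_INR in H1, H2; rewrite mult_INR in H2; simpl in H1, H2.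
pose proof PI_RGT_0; unfold eigvec; apply sin_incr_1; simpl; nra.
Qed.

Lemma run_weight_sum_succ (s : R) (M y m : nat) :
  lsum (words (S m)) (run_weight s M y) =
  s ^ M * (lsum (words m) (run_weight s (Nat.max M (S y)) (S y))
           + match y with
             | O => 0
             | S y' => lsum (words m) (run_weight s M y')
             end).
Proof.
rewrite lsum_words_succ; simpl; rewrite lsum_scal.
destruct y; [rewrite lsum_const | rewrite lsum_scal]; ring.
Qed.

(* [g M * eigvec M (y + 1) / eigvec M 1] is a supersolution of the transfer
   recursion of the weighted walks. *)
Lemma run_weight_sum_bound (s q theta : R) (g : nat -> R) :
  0 < s -> 0 < q ->
  (forall M, q * s ^ M * lam M <= theta) -> theta < 1 ->
  (forall M, 1 <= g M) ->
  (forall M, q * s ^ M * g (S M) <= (1 - theta) * g M) ->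
  forall m M y, (y <= M)%nat ->
  q ^ m * lsum (words m) (run_weight s M y) <= g M * (eigvec M (S y) / eigvec M 1).
Proof.
intros Hs Hq Hth Hth1 Hg1 Hg m; induction m as [|m IH]; intros M y Hy.
- unfold lsum; simpl.
  pose proof (eigvec_pos M 1 ltac:(lia)); pose proof (eigvec_1_le M (S y) ltac:(lia)).
  assert (1 <= eigvec M (S y) / eigvec M 1) by (apply Rle_div_r; lra).
  specialize (Hg1 M); nra.
- rewrite run_weight_sum_succ.
  set (v1 := eigvec M 1); assert (Hv1 : 0 < v1) by (apply eigvec_pos; lia).
  assert (HsM : 0 < q * s ^ M) by (apply Rmult_lt_0_compat; auto; now apply pow_lt).
  assert (Hdown : q ^ m * match y with
     | O => 0 | S y' => lsum (words m) (run_weight s M y') end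
     <= g M * (eigvec M y / v1)).
  { destruct y as [|y']; [rewrite eigvec_0; unfold Rdiv; lra | apply IH; lia]. }
  pose proof (eigvec_rec M y) as Hrec.
  assert (Hpos : 0 <= g M * (eigvec M (S y) / v1)).
  { apply Rmult_le_pos; [specialize (Hg1 M); lra|].
    apply Rlt_le, Rdiv_lt_0_compat; auto; apply eigvec_pos; lia. }
  assert (Hth2 : q * s ^ M * (g M * ((lam M * eigvec M (S y)) / v1))
                 <= theta * (g M * (eigvec M (S y) / v1))).
  { replace (q * s ^ M * (g M * ((lam M * eigvec M (S y)) / v1)))
      with (q * s ^ M * lam M * (g M * (eigvec M (S y) / v1))) by (field; lra).
    apply Rmult_le_compat_r; auto. }
  (* At the top corner the step up leaves the block and enters the corner of level [S M], where the
     normalised vector is 1. Inside the block the missing neighbour has entry 0, so [theta] covers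
     the step down and the slack [1 - theta] pays for the leak. Below the corner the eigenvector
     equation suffices. *)
  destruct (Nat.eq_dec y M) as [->|Hne].
  + rewrite Nat.max_r by lia.
    assert (E : eigvec M (S M) = v1).
    { unfold v1; rewrite <- (eigvec_sym M 1) by lia; f_equal; lia. }
    pose proof (eigvec_end M) as Ee; replace (M + 2)%nat with (S (S M)) in Ee by lia.
    rewrite Ee, Rplus_0_r in Hrec; rewrite <- Hrec in Hth2.
    pose proof (IH (S M) (S M) (le_n _)) as Hup.
    replace (eigvec (S M) (S (S M))) with (eigvec (S M) 1) in Hup
      by (rewrite <- (eigvec_sym (S M) 1) by lia; f_equal; lia).
    pose proof (eigvec_pos (S M) 1 ltac:(lia)).
    rewrite E in *; unfold Rdiv in *; rewrite Rinv_r in * by lra.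
    specialize (Hg M); simpl pow; nra.
  + rewrite Nat.max_l by lia.
    pose proof (IH M (S y) ltac:(lia)) as Hup; fold v1 in Hup.
    rewrite <- Hrec in Hth2; unfold Rdiv in *; simpl pow; nra.
Qed.

Lemma strip_walks_nonneg (k m y : nat) : 0 <= strip_walks k m y.
Proof.
apply lsum_nonneg; intros p _; destruct (in_strip k y p); lra.
Qed.

Lemma strip_walks_succ (k m y : nat) :
  strip_walks k (S m) y =
  (if (y <? k)%nat then strip_walks k m (S y) else 0)
  + match y with O => 0 | S y' => strip_walks k m y' end.
Proof.
unfold strip_walks; rewrite lsum_words_succ; simpl in_strip; f_equal.
- destruct (y <? k)%nat; simpl; [easy | rewrite lsum_const; ring].
- destruct y; simpl; [rewrite lsum_const; ring | easy].
Qed.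

(** One such walk descends to 0 and then zigzags between 0 and 1, which needs [1 <= k]. *)
Lemma strip_walks_ge_1 (k y d : nat) :
  (1 <= k)%nat -> (y <= k)%nat -> 1 <= strip_walks k (y + 2 * d) y.
Proof.
intros Hk; revert y; induction d as [|d IHd].
- induction y as [|y IHy]; intros Hy.
  + unfold strip_walks, lsum; simpl; lra.
  + rewrite Nat.add_succ_l, strip_walks_succ.
    specialize (IHy ltac:(lia)).
    pose proof (strip_walks_nonneg k (y + 2 * 0) (S (S y))).
    simpl in *; destruct (_ <? _)%nat; lra.
- induction y as [|y IHy]; intros Hy.
  + replace (0 + 2 * S d)%nat with (S (1 + 2 * d)) by lia.
    rewrite strip_walks_succ, (proj2 (Nat.ltb_lt 0 k)) by lia.
    specialize (IHd 1%nat ltac:(lia)); lra.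
  + rewrite Nat.add_succ_l, strip_walks_succ.
    specialize (IHy ltac:(lia)).
    pose proof (strip_walks_nonneg k (y + 2 * S d) (S (S y))).
    simpl in *; destruct (_ <? _)%nat; lra.
Qed.

(** Both sides obey the same recursion up to the eigenvalue, so only [m = 0] needs work. The [k]
    extra steps let every start [y] reach 0, and [e] records the parity without which there is no
    walk. At [m = 0] the count is at least 1 and a sine is at most 1. *)
Lemma strip_walks_ge (k m : nat) :
  (1 <= k)%nat ->
  forall y e, (y <= k)%nat -> (y + m + k = 2 * e)%nat ->
  lam k ^ m * eigvec k (S y) <= strip_walks k (k + m) y.
Proof.
intros Hk; induction m as [|m IH]; intros y e Hy He.
- replace (k + 0)%nat with (y + 2 * (e - y))%nat by lia.
  pose proof (strip_walks_ge_1 k y (e - y) Hk Hy).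
  pose proof (SIN_bound (INR (S y) * angle k)).
  unfold eigvec; simpl pow; lra.
- rewrite Nat.add_succ_r, strip_walks_succ.
  simpl pow; rewrite Rmult_assoc, (Rmult_comm (lam k)), Rmult_assoc, (Rmult_comm _ (lam k)).
  rewrite <- eigvec_rec, Rmult_plus_distr_l, Rplus_comm.
  apply Rplus_le_compat.
  + destruct (Nat.ltb_spec y k) as [H|H].
    * apply (IH (S y) e); lia.
    * replace (S (S y)) with (k + 2)%nat by lia; rewrite eigvec_end; lra.
  + destruct y as [|y']; [rewrite eigvec_0; lra | apply (IH y' (e - 1)%nat); lia].
Qed.

(** [s ^ k * lam k] is the growth rate per step in strip [k] when every step weighs [s ^ k]; the
    square accounts for the [2 n] steps of a path of semi-length [n]. *)
Lemma x_lam (k : nat) (s : R) :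
  (1 <= k)%nat -> 0 < s -> x_ k s * (s ^ k * lam k) ^ 2 = 1.
Proof.
intros Hk Hs; unfold x_, lam; fold (angle k); rewrite (Nat.mul_comm 2), pow_mult.
pose proof (cos_angle_ge k Hk); pose proof (pow_lt s k Hs).
field; lra.
Qed.

Lemma x_pos (k : nat) (s : R) : (1 <= k)%nat -> 0 < s -> 0 < x_ k s.
Proof.
intros Hk Hs; unfold x_; fold (angle k).
pose proof (cos_angle_ge k Hk); pose proof (pow_lt s (2 * k) Hs).
apply Rdiv_lt_0_compat; [lra|].
apply Rmult_lt_0_compat; [lra | apply pow_lt; lra].
Qed.

Lemma pow_unbounded (r C c : R) : 1 < r -> 0 < c -> exists n : nat, C < c * r ^ n.
Proof.
intros Hr Hc; destruct (Pow_x_infinity r ltac:(rewrite Rabs_pos_eq; lra) (C / c + 1)) as [n Hn].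
exists n; specialize (Hn n (le_n _)).
rewrite Rabs_pos_eq in Hn by (apply pow_le; lra).
assert (C / c < r ^ n) by lra.
apply Rlt_div_l in H; lra.
Qed.

(** * The radius of convergence *)

Lemma x_c_le (s : R) (k : nat) :
  0 < s <= 1 -> (1 <= k)%nat -> Rbar_le (x_c s) (x_ k s).
Proof.
intros Hs Hk; destruct (CV_radius_bounded (hull_coeff s)) as [_ Hlub].
apply Hlub; intros r [M HM]; simpl.
pose proof (x_pos k s Hk ltac:(lra)) as Hx; pose proof (x_lam k s Hk ltac:(lra)) as Hl.
destruct (Rle_lt_dec r (x_ k s)) as [H|H]; auto; exfalso.
set (t := s ^ k * lam k) in *.
assert (Hr : 1 < r * t ^ 2).
{ rewrite <- Hl; apply Rmult_lt_compat_r; auto.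
  destruct (Req_dec t 0) as [E|E]; [rewrite E in Hl; simpl in Hl; lra|].
  apply pow2_gt_0; auto. }
(* The strip estimate is used at semi-length [n + k]. This constant collects the factors of the
   extra [2 k] steps, those of [lam k] being dropped because [lam k >= 1]. *)
set (c := s ^ (2 * k * k) * eigvec k 1 * r ^ k).
assert (Hc : 0 < c).
{ pose proof (eigvec_pos k 1 ltac:(lia)); pose proof (pow_lt r k ltac:(lra)).
  pose proof (pow_lt s (2 * k * k) ltac:(lra)).
  unfold c; repeat apply Rmult_lt_0_compat; auto. }
destruct (pow_unbounded _ M c Hr Hc) as [n Hn].
specialize (HM (n + k)%nat).
assert (Hw := strip_walks_ge k (k + 2 * n) Hk 0%nat (k + n)%nat ltac:(lia) ltac:(lia)).
replace (k + (k + 2 * n))%nat with (2 * (n + k))%nat in Hw by lia.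
assert (Hh := hull_coeff_ge s k (n + k) Hs).
assert (Hlam : 1 <= lam k) by (unfold lam; pose proof (cos_angle_ge k Hk); lra).
assert (Hw2 : lam k ^ (2 * n) * eigvec k 1 <= strip_walks k (2 * (n + k)) 0).
{ apply Rle_trans with (2 := Hw); apply Rmult_le_compat_r.
  - apply Rlt_le, eigvec_pos; lia.
  - apply Rle_pow; auto; lia. }
apply (Rlt_irrefl M); apply Rlt_le_trans with (1 := Hn).
apply Rle_trans with (2 := HM).
apply Rle_trans with (2 := Rle_abs _).
apply Rle_trans with (s ^ (k * (2 * (n + k))) * (lam k ^ (2 * n) * eigvec k 1) * r ^ (n + k)).
- right; unfold c, t.
  rewrite !Rpow_mult_distr, <- !pow_mult.
  replace (k * (2 * (n + k)))%nat with (2 * k * k + k * (2 * n))%nat by lia.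
  rewrite !pow_add; ring.
- apply Rmult_le_compat_r; [apply pow_le; lra|].
  apply Rle_trans with (2 := Hh); apply Rmult_le_compat_l; auto; apply pow_le; lra.
Qed.

(** Bernoulli's inequality for [/ t]. It absorbs the linear factor that comes from the cut. *)
Lemma linear_le_pow (t : R) :
  0 < t < 1 -> exists C, forall n, INR n * t ^ n <= C.
Proof.
intros Ht; set (d := / t - 1).
assert (Hd : 0 < d) by (unfold d; pose proof (Rinv_lt_contravar t 1 ltac:(lra) ltac:(lra)); lra).
exists (/ d); intros n.
pose proof (poly n d Hd) as H; replace (1 + d) with (/ t) in H by (unfold d; ring).
rewrite pow_inv in H.
pose proof (pow_lt t n ltac:(lra)) as Hp.
apply Rmult_le_reg_l with d; auto; rewrite Rinv_r by lra.
assert (H1 : (1 + INR n * d) * t ^ n <= / t ^ n * t ^ n) by (apply Rmult_le_compat_r; lra).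
rewrite Rinv_l in H1 by lra; nra.
Qed.

Lemma hull_coeff_bounded (s q theta : R) :
  0 < s < 1 -> 0 < q ->
  (forall M, q * s ^ M * lam M <= theta) -> theta < 1 ->
  exists C, forall n, hull_coeff s n * (q ^ 2) ^ n <= INR (S (2 * n)) * C.
Proof.
intros Hs Hq Hth Hth1.
set (Q := q / (1 - theta)).
assert (HQ : 0 < Q) by (apply Rdiv_lt_0_compat; lra).
destruct (pow_lt_1_zero s ltac:(rewrite Rabs_pos_eq; lra) (/ Q) (Rinv_0_lt_compat _ HQ)) as [M0 HM0].
(* The condition on [g] reads [s ^ M * Q * g (S M) <= g M]. From [M0] on, [s ^ M * Q < 1] and [g]
   can be constant; below [M0] a ratio [C >= Q] per level is enough because [s ^ M <= 1]. *)
set (C := Rmax 1 Q); set (g := fun M => C ^ (M0 - M)).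
assert (HC1 : 1 <= C) by apply Rmax_l; assert (HCQ : Q <= C) by apply Rmax_r.
assert (Hg1 : forall M, 1 <= g M) by (intros M; apply pow_R1_Rle; auto).
assert (Hg : forall M, q * s ^ M * g (S M) <= (1 - theta) * g M).
{ intros M; replace q with ((1 - theta) * Q) by (unfold Q; field; lra).
  rewrite !Rmult_assoc; apply Rmult_le_compat_l; [lra|]; unfold g.
  pose proof (pow_lt s M ltac:(lra)).
  destruct (Nat.le_gt_cases M0 M) as [H1|H1].
  - replace (M0 - S M)%nat with 0%nat by lia; replace (M0 - M)%nat with 0%nat by lia.
    specialize (HM0 M H1); rewrite Rabs_pos_eq in HM0 by lra; simpl.
    apply (Rmult_lt_compat_l Q) in HM0; auto; rewrite Rinv_r in HM0 by lra; lra.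
  - replace (M0 - M)%nat with (S (M0 - S M)) by lia; simpl.
    pose proof (pow_le C (M0 - S M) ltac:(lra)).
    pose proof (pow_antitone s M 0 ltac:(lra) ltac:(lia)) as H2; simpl in H2.
    rewrite <- Rmult_assoc; apply Rmult_le_compat_r; auto; nra. }
assert (Hb := run_weight_sum_bound s q theta g ltac:(lra) Hq Hth Hth1 Hg1 Hg).
assert (Hb0 : forall m, 0 <= q ^ m * lsum (words m) (run_weight s 0 0) <= g 0%nat).
{ intros m; split.
  - apply Rmult_le_pos; [apply pow_le; lra|].
    apply lsum_nonneg; intros p _; apply run_weight_nonneg; lra.
  - specialize (Hb m 0%nat 0%nat (le_n _)).
    pose proof (eigvec_pos 0 1 ltac:(lia)).
    unfold Rdiv in Hb; rewrite Rinv_r in Hb by lra; lra. }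
exists (g 0%nat * g 0%nat); intros n.
rewrite <- (length_seq (S (2 * n)) 0), <- lsum_const.
apply Rle_trans with (1 := Rmult_le_compat_r _ _ _ (pow_le (q ^ 2) n ltac:(nra))
  (hull_coeff_le s n ltac:(lra))).
rewrite Rmult_comm, <- lsum_scal; apply lsum_le; intros a Ha; apply in_seq in Ha.
rewrite <- pow_mult; replace (2 * n)%nat with (a + (2 * n - a))%nat at 1 by lia.
rewrite pow_add.
pose proof (Hb0 a); pose proof (Hb0 (2 * n - a)%nat).
match goal with |- ?A * ?B * (?X * ?Y) <= _ =>
  replace (A * B * (X * Y)) with ((A * X) * (B * Y)) by ring end.
apply Rmult_le_compat; lra.
Qed.

Lemma x_c_ge (s m : R) :
  0 < s < 1 -> 0 < m -> (forall k, (1 <= k)%nat -> m <= x_ k s) -> Rbar_le m (x_c s).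
Proof.
intros Hs Hm Hmin; destruct (CV_radius_bounded (hull_coeff s)) as [Hub _].
(* One factor [u ^ 2] makes all levels subcritical with the same [theta = u]; the other absorbs the
   factor [2 n + 1]. Then [u] tends to 1. *)
assert (Hsub : forall u, 0 < u < 1 -> Rbar_le (u ^ 2 * (u ^ 2 * m)) (x_c s)).
{ intros u Hu; apply Hub.
  set (q := u * sqrt m).
  assert (Hq2 : q ^ 2 = u ^ 2 * m) by (unfold q; rewrite Rpow_mult_distr, pow2_sqrt; lra).
  assert (Hq : 0 < q) by (apply Rmult_lt_0_compat; [lra | now apply sqrt_lt_R0]).
  destruct (hull_coeff_bounded s q u Hs Hq) as [C HC]; [|lra|].
  - intros M; rewrite Rmult_assoc.
    pose proof (lam_nonneg M) as HlM; pose proof (pow_lt s M ltac:(lra)) as HsM.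
    destruct M as [|M].
    (* Level 0 allows no step inside its strip: [lam 0 = 0]. Hence the minimum runs over [k >= 1]
       only. *)
    + unfold lam, angle; simpl Nat.add; rewrite INR_IZR_INZ; simpl IZR; rewrite cos_PI2; lra.
    + pose proof (x_lam (S M) s ltac:(lia) ltac:(lra)) as Hl.
      specialize (Hmin (S M) ltac:(lia)).
      set (t := s ^ S M * lam (S M)) in *.
      assert (Ht : 0 <= t) by (apply Rmult_le_pos; lra).
      apply Rsqr_incr_0_var; [|lra]; unfold Rsqr.
      replace (q * t * (q * t)) with (q ^ 2 * t ^ 2) by ring; rewrite Hq2.
      assert (m * t ^ 2 <= x_ (S M) s * t ^ 2) by (apply Rmult_le_compat_r; auto; apply pow2_ge_0).
      nra.
  - destruct (linear_le_pow (u ^ 2) ltac:(nra)) as [L HL].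
    assert (HC0 : 0 <= C).
    { specialize (HC 0%nat); simpl in HC; unfold hull_coeff in HC; simpl in HC.
      unfold dyck_paths in HC; simpl in HC; lra. }
    exists ((2 * L + 1) * C); intros n.
    pose proof (hull_coeff_nonneg s n ltac:(lra)) as H0.
    specialize (HC n); specialize (HL n).
    rewrite <- Hq2, Rpow_mult_distr.
    assert (Hu2 : 0 <= (u ^ 2) ^ n <= 1).
    { split; [apply pow_le; nra|].
      pose proof (pow_incr (u ^ 2) 1 n ltac:(nra)) as H1; now rewrite pow1 in H1. }
    assert (Hqn : 0 <= (q ^ 2) ^ n) by (apply pow_le; nra).
    rewrite Rabs_pos_eq by (repeat apply Rmult_le_pos; lra).
    apply Rle_trans with ((u ^ 2) ^ n * (INR (S (2 * n)) * C)).
    + replace (hull_coeff s n * ((u ^ 2) ^ n * (q ^ 2) ^ n))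
        with ((u ^ 2) ^ n * (hull_coeff s n * (q ^ 2) ^ n)) by ring.
      apply Rmult_le_compat_l; lra.
    + rewrite S_INR, mult_INR, <- Rmult_assoc; apply Rmult_le_compat_r; auto.
      simpl (INR 2); nra. }
destruct (x_c s) as [x| |] eqn:E; simpl in *.
- destruct (Rle_lt_dec m x) as [H|H]; auto; exfalso.
  assert (Hx : 0 < x) by (specialize (Hsub (1 / 2) ltac:(lra)); nra).
  (* Chosen so that [u ^ 4 * m] is the midpoint of [x] and [m], which exceeds [x]. *)
  set (u := sqrt (sqrt ((1 + x / m) / 2))).
  assert (Hxm : 0 < x / m < 1).
  { split; [now apply Rdiv_lt_0_compat|]; apply Rlt_div_l; lra. }
  assert (Hu4 : u ^ 2 * u ^ 2 = (1 + x / m) / 2).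
  { unfold u; rewrite !pow2_sqrt; try (apply sqrt_pos); rewrite sqrt_sqrt; lra. }
  assert (Hu : 0 < u < 1).
  { split; [unfold u; repeat apply sqrt_lt_R0; lra|].
    destruct (Rlt_le_dec u 1) as [H1|H1]; auto; exfalso.
    assert (1 <= u ^ 2) by nra; nra. }
  assert (H2 : u ^ 2 * (u ^ 2 * m) <= x) by exact (Hsub u Hu).
  rewrite <- Rmult_assoc, Hu4 in H2.
  assert (x / m * m = x) by (field; lra).
  nra.
- easy.
- specialize (Hsub (1 / 2) ltac:(lra)); easy.
Qed.

(** * Elementary two-sided bounds for the branches, and existence of their minimum *)

Lemma cos_taylor (t : R) :
  0 <= t <= 2 -> 1 - t ^ 2 / 2 <= cos t <= 1 - t ^ 2 / 2 + t ^ 4 / 24.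
Proof.
intros Ht; pose proof (pre_cos_bound t 0 ltac:(lra) ltac:(lra)) as H.
unfold cos_approx, cos_term in H; simpl in H; lra.
Qed.

Lemma sin_taylor (t : R) : 0 <= t <= 2 -> t - t ^ 3 / 6 <= sin t.
Proof.
intros Ht; pose proof (pre_sin_bound t 0 ltac:(lra) ltac:(lra)) as H.
unfold sin_approx, sin_term in H; simpl in H; lra.
Qed.

(** After multiplication by the squared cosine this is [t * cos t <= sin t], which the Taylor bounds
    give as long as [t ^ 2 <= 8]. *)
Lemma inv_cos2_ge (t : R) : 0 < t <= 2 -> 0 < cos t -> 1 + t ^ 2 <= / cos t ^ 2.
Proof.
intros Ht Hc; pose proof (cos_taylor t ltac:(lra)); pose proof (sin_taylor t ltac:(lra)).
assert (Htan : t * cos t <= sin t).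
{ apply Rle_trans with (t * (1 - t ^ 2 / 2 + t ^ 4 / 24)); [apply Rmult_le_compat_l; lra|].
  assert (0 <= t ^ 3) by (apply pow_le; lra); nra. }
pose proof (sin2_cos2 t) as Hsc; unfold Rsqr in Hsc.
assert (0 < cos t ^ 2) by (apply pow_lt; auto).
apply Rmult_le_reg_r with (cos t ^ 2); auto; rewrite Rinv_l by lra.
assert (0 <= t * cos t) by (apply Rmult_le_pos; lra).
nra.
Qed.

Lemma inv_cos2_le (t : R) : 0 < t < 1 -> / cos t ^ 2 <= / (1 - t ^ 2).
Proof.
intros Ht; apply Rinv_le_contravar; [nra|].
pose proof (sin2_cos2 t) as Hsc; unfold Rsqr in Hsc.
pose proof (sin_lt_x t ltac:(lra)).
assert (0 <= sin t) by (pose proof PI_RGT_0; pose proof PI2_1; apply sin_ge_0; lra).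
nra.
Qed.

Lemma bernoulli_pow (e : R) (n : nat) : 0 <= e <= 1 -> 1 - INR n * e <= (1 - e) ^ n.
Proof.
intros He; induction n as [|n IH]; [simpl; lra|].
rewrite S_INR; simpl.
assert (0 <= (1 - e) ^ n) by (apply pow_le; lra).
pose proof (pos_INR n); nra.
Qed.

Lemma inv_pow_ge (e : R) (n : nat) : 0 < e < 1 -> 1 + INR n * e <= / (1 - e) ^ n.
Proof.
intros He; rewrite <- pow_inv.
apply Rle_trans with ((1 + e) ^ n); [apply poly; lra|].
apply pow_incr; split; [lra|].
apply Rmult_le_reg_r with (1 - e); [lra|]; rewrite Rinv_l by lra; nra.
Qed.

Lemma inv_pow_le (e : R) (n : nat) :
  0 < e < 1 -> INR n * e < 1 -> / (1 - e) ^ n <= / (1 - INR n * e).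
Proof. intros He Hn; apply Rinv_le_contravar; [lra | apply bernoulli_pow; lra]. Qed.

Lemma x_factor (k : nat) (s : R) :
  (1 <= k)%nat -> 0 < s -> x_ k s = / s ^ (2 * k) * / cos (angle k) ^ 2 / 4.
Proof.
intros Hk Hs; unfold x_; fold (angle k).
pose proof (cos_angle_ge k Hk); pose proof (pow_lt s (2 * k) Hs); field; lra.
Qed.

Lemma x_ge (k : nat) (s : R) :
  0 < s < 1 -> (1 <= k)%nat ->
  (1 + 2 * INR k * (1 - s)) * (1 + angle k ^ 2) / 4 <= x_ k s.
Proof.
intros Hs Hk; rewrite x_factor by (auto; lra).
pose proof (inv_pow_ge (1 - s) (2 * k) ltac:(lra)) as H1.
rewrite mult_INR in H1; replace (1 - (1 - s)) with s in H1 by ring; simpl (INR 2) in H1.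
pose proof (cos_angle_ge k Hk); pose proof (angle_pos k); pose proof (angle_le_PI2 k).
pose proof PI_4.
pose proof (inv_cos2_ge (angle k) ltac:(lra) ltac:(lra)) as Hcos.
apply Rmult_le_compat_r; [lra|].
pose proof (pos_INR k); pose proof (pow2_ge_0 (angle k)).
apply Rmult_le_compat; try lra; apply Rplus_le_le_0_compat; try lra.
apply Rmult_le_pos; lra.
Qed.

Lemma x_le (k : nat) (s : R) :
  0 < s < 1 -> (1 <= k)%nat -> 2 * INR k * (1 - s) < 1 -> angle k < 1 ->
  x_ k s <= / (1 - 2 * INR k * (1 - s)) * / (1 - angle k ^ 2) / 4.
Proof.
intros Hs Hk H1 H2; rewrite x_factor by (auto; lra).
pose proof (angle_pos k); pose proof (cos_angle_ge k Hk).
pose proof (inv_pow_le (1 - s) (2 * k) ltac:(lra)) as H3.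
rewrite mult_INR in H3; replace (1 - (1 - s)) with s in H3 by ring; simpl (INR 2) in H3.
apply Rmult_le_compat_r; [lra|]; apply Rmult_le_compat.
- apply Rlt_le, Rinv_0_lt_compat, pow_lt; lra.
- apply Rlt_le, Rinv_0_lt_compat, pow_lt; lra.
- apply H3; lra.
- apply inv_cos2_le; lra.
Qed.

(** By [x_ge] the branches grow at least linearly in [k], so only finitely many indices compete with
    [x_ 1 s]. *)
Lemma x_min_exists (s : R) :
  0 < s < 1 ->
  exists k, (1 <= k)%nat /\ forall j, (1 <= j)%nat -> x_ k s <= x_ j s.
Proof.
intros Hs.
assert (Hfin : forall N, exists k, (1 <= k)%nat /\
   forall j, (1 <= j <= S N)%nat -> x_ k s <= x_ j s).
{ intros N; induction N as [|N [k [Hk H]]].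
  - exists 1%nat; split; [lia|]; intros j Hj; replace j with 1%nat by lia; lra.
  - destruct (Rle_lt_dec (x_ k s) (x_ (S (S N)) s)) as [H1|H1].
    + exists k; split; auto; intros j Hj.
      destruct (Nat.eq_dec j (S (S N))) as [->|]; auto; apply H; lia.
    + exists (S (S N)); split; [lia|]; intros j Hj.
      destruct (Nat.eq_dec j (S (S N))) as [->|]; [lra|].
      specialize (H j ltac:(lia)); lra. }
destruct (INR_unbounded (4 * x_ 1 s / (2 * (1 - s)))) as [N HN].
destruct (Hfin N) as [k [Hk H]]; exists k; split; auto; intros j Hj.
destruct (Nat.le_gt_cases j (S N)) as [HjN|HjN]; [apply H; lia|].
apply Rle_trans with (1 := H 1%nat ltac:(lia)).
apply Rle_trans with (2 := x_ge j s Hs Hj).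
apply Rlt_div_l in HN; [|lra].
pose proof (lt_INR N j ltac:(lia)).
pose proof (pow2_ge_0 (angle j)).
assert (4 * x_ 1 s <= 1 + 2 * INR j * (1 - s)) by nra.
pose proof (x_pos 1 s ltac:(lia) ltac:(lra)); nra.
Qed.

Lemma x_c_attained (s : R) :
  0 < s < 1 ->
  exists k, (1 <= k)%nat /\ x_c s = Finite (x_ k s)
    /\ forall j, (1 <= j)%nat -> x_ k s <= x_ j s.
Proof.
intros Hs; destruct (x_min_exists s Hs) as [k [Hk Hmin]].
exists k; repeat split; auto.
apply Rbar_le_antisym; [apply x_c_le; auto; lra|].
apply x_c_ge; auto; apply x_pos; auto; lra.
Qed.

(** * Crossing of consecutive branches *)

Lemma s_eq (k : nat) : s_ k = cos (angle k) / cos (angle (S k)).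
Proof. unfold s_, angle; now replace (k + 3)%nat with (S k + 2)%nat by lia. Qed.

Lemma cos_angle_lt (k : nat) : cos (angle k) < cos (angle (S k)).
Proof.
pose proof (angle_pos (S k)); pose proof (angle_le_PI2 k); pose proof PI_RGT_0.
assert (angle (S k) < angle k).
{ unfold angle; apply Rmult_lt_compat_l; auto.
  apply Rinv_lt_contravar; [apply Rmult_lt_0_compat; apply INR_pos; lia|].
  apply lt_INR; lia. }
apply cos_decreasing_1; lra.
Qed.

Lemma s_bounds (k : nat) : (1 <= k)%nat -> 0 < s_ k < 1.
Proof.
intros Hk; rewrite s_eq.
pose proof (cos_angle_ge k Hk); pose proof (cos_angle_lt k).
split; [apply Rdiv_lt_0_compat; lra | apply Rlt_div_l; lra].
Qed.

(** The order of two consecutive branches is thus decided by comparing [s] with [s_ k]. *)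
Lemma x_ratio (k : nat) (s : R) :
  (1 <= k)%nat -> 0 < s -> x_ (S k) s = x_ k s * (s_ k / s) ^ 2.
Proof.
intros Hk Hs; rewrite s_eq; unfold x_; fold (angle k); fold (angle (S k)).
pose proof (cos_angle_ge k Hk); pose proof (cos_angle_lt k).
pose proof (pow_lt s (2 * k) Hs).
replace (2 * S k)%nat with (2 * k + 2)%nat by lia; rewrite pow_add.
field; repeat split; lra.
Qed.

Lemma x_crossing (k : nat) :
  (1 <= k)%nat ->
  0 < s_ k < 1
  /\ x_ k (s_ k) = x_ (S k) (s_ k)
  /\ (forall s : R, 0 < s < s_ k -> x_ k s < x_ (S k) s)
  /\ (forall s : R, s_ k < s < 1 -> x_ (S k) s < x_ k s).
Proof.
intros Hk; pose proof (s_bounds k Hk) as Hs; repeat split; try lra.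
- rewrite x_ratio by (auto; lra); field; lra.
- intros s H; rewrite x_ratio by (auto; lra).
  assert (1 < s_ k / s) by (apply Rlt_div_r; lra).
  pose proof (x_pos k s Hk ltac:(lra)).
  rewrite <- (Rmult_1_r (x_ k s)) at 1; apply Rmult_lt_compat_l; auto; nra.
- intros s H; rewrite x_ratio by (auto; lra).
  assert (s_ k / s < 1) by (apply Rlt_div_l; lra).
  assert (0 < s_ k / s) by (apply Rdiv_lt_0_compat; lra).
  pose proof (x_pos k s Hk ltac:(lra)).
  rewrite <- (Rmult_1_r (x_ k s)) at 2; apply Rmult_lt_compat_l; auto; nra.
Qed.

(** * Asymptotics of the crossing points *)

Definition bigO_pow (m : nat) (u : nat -> R) : Prop :=
  bigO_seq u (fun k => / INR k ^ m).

(** A normal form with a non-negative constant and [1 <= k], away from the inverse of 0. *)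
Lemma bigO_pow_alt (m : nat) (u : nat -> R) :
  bigO_pow m u <->
  exists C, 0 <= C /\ eventually (fun k => (1 <= k)%nat /\ Rabs (u k) <= C * / INR k ^ m).
Proof.
assert (He : forall k, (1 <= k)%nat -> 0 < / INR k ^ m)
  by (intros k Hk; apply Rinv_0_lt_compat, pow_lt, INR_pos; lia).
split.
- intros [C HC]; exists (Rabs C); split; [apply Rabs_pos|].
  destruct HC as [N HN]; exists (S N); intros k Hk; split; [lia|].
  specialize (HN k ltac:(lia)); specialize (He k ltac:(lia)).
  rewrite (Rabs_pos_eq (/ _)) in HN by lra.
  apply Rle_trans with (1 := HN); apply Rmult_le_compat_r; [lra | apply Rle_abs].
- intros [C [_ [N HN]]]; exists C; exists (S N); intros k Hk.
  specialize (HN k ltac:(lia)); specialize (He k ltac:(lia)).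
  rewrite (Rabs_pos_eq (/ _)) by lra; apply HN.
Qed.

Lemma bigO_pow_dom (m : nat) (u v : nat -> R) (c : R) :
  eventually (fun k => Rabs (u k) <= c * Rabs (v k)) -> bigO_pow m v -> bigO_pow m u.
Proof.
intros [N1 H1] [C [N2 H2]]; exists (Rabs c * C); exists (N1 + N2)%nat; intros k Hk.
specialize (H1 k ltac:(lia)); specialize (H2 k ltac:(lia)).
apply Rle_trans with (1 := H1); rewrite Rmult_assoc.
apply Rle_trans with (Rabs c * Rabs (v k)).
- apply Rmult_le_compat_r; [apply Rabs_pos | apply Rle_abs].
- apply Rmult_le_compat_l; [apply Rabs_pos | easy].
Qed.

Lemma bigO_pow_ext (m : nat) (u v : nat -> R) :
  (forall k, (1 <= k)%nat -> u k = v k) -> bigO_pow m v -> bigO_pow m u.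
Proof.
intros H; apply (bigO_pow_dom m u v 1); exists 1%nat; intros k Hk.
rewrite H by easy; lra.
Qed.

Lemma bigO_pow_add (m : nat) (u v : nat -> R) :
  bigO_pow m u -> bigO_pow m v -> bigO_pow m (fun k => u k + v k).
Proof.
intros [C1 [N1 H1]] [C2 [N2 H2]]; exists (C1 + C2); exists (N1 + N2)%nat; intros k Hk.
specialize (H1 k ltac:(lia)); specialize (H2 k ltac:(lia)).
apply Rle_trans with (1 := Rabs_triang _ _); lra.
Qed.

Lemma bigO_pow_mul (m n : nat) (u v : nat -> R) :
  bigO_pow m u -> bigO_pow n v -> bigO_pow (m + n) (fun k => u k * v k).
Proof.
intros [C1 [N1 H1]] [C2 [N2 H2]]; exists (C1 * C2); exists (N1 + N2)%nat; intros k Hk.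
specialize (H1 k ltac:(lia)); specialize (H2 k ltac:(lia)).
rewrite Rabs_mult, pow_add, Rinv_mult, Rabs_mult.
pose proof (Rmult_le_compat _ _ _ _ (Rabs_pos _) (Rabs_pos _) H1 H2); lra.
Qed.

Lemma bigO_pow_const (c : R) : bigO_pow 0 (fun _ => c).
Proof.
exists (Rabs c); exists 0%nat; intros k _.
simpl; rewrite Rinv_1, Rabs_R1; lra.
Qed.

Lemma bigO_pow_scal (m : nat) (c : R) (u : nat -> R) :
  bigO_pow m u -> bigO_pow m (fun k => c * u k).
Proof. apply (bigO_pow_mul 0 m), bigO_pow_const. Qed.

Lemma bigO_pow_sub (m : nat) (u v : nat -> R) :
  bigO_pow m u -> bigO_pow m v -> bigO_pow m (fun k => u k - v k).
Proof.
intros Hu Hv; apply (bigO_pow_ext _ _ (fun k => u k + -1 * v k)); [intros; ring|].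
apply bigO_pow_add, bigO_pow_scal; auto.
Qed.

Lemma bigO_pow_inv (m : nat) : bigO_pow m (fun k => / INR k ^ m).
Proof. exists 1; exists 0%nat; intros k _; lra. Qed.

Lemma bigO_pow_weaken (m n : nat) (u : nat -> R) :
  (n <= m)%nat -> bigO_pow m u -> bigO_pow n u.
Proof.
intros Hmn; rewrite !bigO_pow_alt; intros [C [HC [N H]]]; exists C; split; auto.
exists N; intros k Hk; specialize (H k Hk) as [H1 H2]; split; auto.
apply Rle_trans with (1 := H2); apply Rmult_le_compat_l; auto.
apply Rinv_le_contravar; [apply pow_lt, INR_pos; lia|].
apply Rle_pow; auto; apply (le_INR 1); easy.
Qed.

Lemma bigO_pow_mul_INR (m : nat) (u : nat -> R) :
  bigO_pow (S m) u -> bigO_pow m (fun k => INR k * u k).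
Proof.
rewrite !bigO_pow_alt; intros [C [HC [N H]]]; exists C; split; auto.
exists N; intros k Hk; specialize (H k Hk) as [H1 H2]; split; auto.
pose proof (INR_pos k ltac:(lia)) as Hp; pose proof (pow_lt (INR k) m Hp).
rewrite Rabs_mult, Rabs_pos_eq by lra.
apply Rle_trans with (INR k * (C * / INR k ^ S m)); [apply Rmult_le_compat_l; lra|].
right; simpl; field; lra.
Qed.

Lemma bigO_pow_small (m : nat) (u : nat -> R) (e : R) :
  0 < e -> bigO_pow (S m) u -> eventually (fun k => Rabs (u k) < e).
Proof.
intros He Hu; apply (bigO_pow_weaken _ 1) in Hu; [|lia].
apply bigO_pow_alt in Hu as [C [HC [N H]]].
destruct (INR_unbounded (C / e)) as [N2 H2].
exists (N + N2)%nat; intros k Hk; specialize (H k ltac:(lia)) as [H3 H4].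
apply Rle_lt_trans with (1 := H4); rewrite pow_1.
pose proof (le_INR N2 k ltac:(lia)); pose proof (INR_pos k ltac:(lia)).
assert (C < INR k * e) by (apply Rlt_div_l; lra).
apply (Rmult_lt_reg_r (INR k)); auto; rewrite Rmult_assoc, Rinv_l by lra; lra.
Qed.

Lemma angle_bigO : bigO_pow 1 angle.
Proof.
apply (bigO_pow_dom _ _ (fun k => / INR k ^ 1) PI); [|apply bigO_pow_inv].
exists 1%nat; intros k Hk; pose proof (angle_pos k); pose proof PI_RGT_0.
pose proof (INR_pos k ltac:(lia)).
rewrite pow_1, !Rabs_pos_eq; try lra; [|apply Rlt_le, Rinv_0_lt_compat; lra].
apply Rmult_le_compat_l; [lra|]; apply Rinv_le_contravar; auto.
apply le_INR; lia.
Qed.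

Lemma angle_sq_bigO : bigO_pow 3 (fun k => angle k ^ 2 - PI ^ 2 / INR k ^ 2).
Proof.
(* An exact identity, from k^2 - (k + 2)^2 = -4k - 4. *)
apply (bigO_pow_ext _ _ (fun k => -4 * (angle k ^ 2 * / INR k ^ 1)
                                  + -4 * (angle k ^ 2 * / INR k ^ 2))).
- intros k Hk; unfold angle; rewrite plus_INR; simpl (INR 2).
  pose proof (INR_pos k ltac:(lia)); field; lra.
- assert (H2 : bigO_pow 2 (fun k => angle k ^ 2)).
  { apply (bigO_pow_ext _ _ (fun k => angle k * angle k)); [intros; ring|].
    apply (bigO_pow_mul 1 1); apply angle_bigO. }
  apply bigO_pow_add; apply bigO_pow_scal.
  + apply (bigO_pow_mul 2 1); auto; apply bigO_pow_inv.
  + apply (bigO_pow_weaken 4); [lia|].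
    apply (bigO_pow_mul 2 2); auto; apply bigO_pow_inv.
Qed.

Lemma bigO_pow_shift (m : nat) (u : nat -> R) :
  bigO_pow m u -> bigO_pow m (fun k => u (S k)).
Proof.
rewrite !bigO_pow_alt; intros [C [HC [N H]]]; exists C; split; auto.
exists (S N); intros k Hk; specialize (H (S k) ltac:(lia)) as [H1 H2]; split; [lia|].
apply Rle_trans with (1 := H2); apply Rmult_le_compat_l; auto.
pose proof (INR_pos k ltac:(lia)).
apply Rinv_le_contravar; [now apply pow_lt|].
apply pow_incr; rewrite S_INR; lra.
Qed.

Lemma bigO_pow_square (m : nat) (u : nat -> R) :
  bigO_pow m u -> bigO_pow (m + m) (fun k => u k ^ 2).
Proof.
intros H; apply (bigO_pow_ext _ _ (fun k => u k * u k)); [intros; ring|].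
now apply bigO_pow_mul.
Qed.

Lemma angle_sq_bigO_2 : bigO_pow 2 (fun k => angle k ^ 2).
Proof. apply (bigO_pow_square 1), angle_bigO. Qed.

Lemma angle_le_2 (k : nat) : 0 < angle k <= 2.
Proof. pose proof (angle_pos k); pose proof (angle_le_PI2 k); pose proof PI_4; lra. Qed.

Lemma cos_angle_bigO : bigO_pow 4 (fun k => cos (angle k) - 1 + angle k ^ 2 / 2).
Proof.
apply (bigO_pow_dom _ _ (fun k => (angle k ^ 2) ^ 2) (/ 24)).
- exists 0%nat; intros k _; pose proof (angle_le_2 k).
  pose proof (cos_taylor (angle k) ltac:(lra)).
  assert (0 <= (angle k ^ 2) ^ 2) by apply pow2_ge_0.
  rewrite !Rabs_pos_eq; try lra; nra.
- apply (bigO_pow_square 2), angle_sq_bigO_2.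
Qed.

Lemma angle_sq_diff_bigO :
  bigO_pow 4 (fun k => angle k ^ 2 / 2 - angle (S k) ^ 2 / 2 - PI ^ 2 / INR k ^ 3).
Proof.
pose proof angle_sq_bigO_2 as Ha; pose proof (bigO_pow_shift _ _ Ha) as Hb.
set (w := fun k => / PI ^ 2 * (angle k ^ 2 * angle (S k) ^ 2)).
assert (Hw : bigO_pow 4 w) by (apply bigO_pow_scal, (bigO_pow_mul 2 2); auto).
(* An exact identity. With P = (k + 2)^2 (k + 3)^2, the bracket is k + 5/2 - P / k^3, where P = k^4
   + 10k^3 + 37k^2 + 60k + 36; the terms in k cancel. *)
apply (bigO_pow_ext _ _ (fun k =>
  w k * (- (15 / 2) - 37 * / INR k ^ 1 - 60 * / INR k ^ 2 - 36 * / INR k ^ 3))).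
- intros k Hk; unfold w, angle; rewrite !plus_INR, (S_INR k); simpl (INR 2).
  pose proof (INR_pos k ltac:(lia)); pose proof PI_RGT_0; field; lra.
- apply (bigO_pow_mul 4 0); auto.
  assert (Hi : forall c m, bigO_pow 0 (fun k => c * / INR k ^ m)).
  { intros c m; apply bigO_pow_scal, (bigO_pow_weaken m); [lia | apply bigO_pow_inv]. }
  repeat apply bigO_pow_sub; auto; apply bigO_pow_const.
Qed.

Lemma inv_cos_bigO : bigO_pow 0 (fun k => / cos (angle k)).
Proof.
exists 2; exists 1%nat; intros k Hk; pose proof (cos_angle_ge k Hk).
simpl; rewrite Rinv_1, Rabs_R1, Rabs_pos_eq by (apply Rlt_le, Rinv_0_lt_compat; lra).
replace (2 * 1) with (/ (1 / 2)) by field; apply Rinv_le_contravar; lra.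
Qed.

Lemma s_bigO : bigO_pow 4 (fun k => s_ k - (1 - PI ^ 2 / INR k ^ 3)).
Proof.
pose proof cos_angle_bigO as Ha; pose proof (bigO_pow_shift _ _ Ha) as Hb.
assert (Hc : bigO_pow 2 (fun k => cos (angle (S k)) - 1)).
{ apply (bigO_pow_ext _ _ (fun k => (cos (angle (S k)) - 1 + angle (S k) ^ 2 / 2)
                                    + - (1 / 2) * angle (S k) ^ 2)); [intros; field|].
  apply bigO_pow_add; [apply (bigO_pow_weaken 4); auto|].
  apply bigO_pow_scal, (bigO_pow_shift 2 (fun k => angle k ^ 2)), angle_sq_bigO_2. }
(* With the common denominator taken out, the numerator splits into two Taylor remainders, the
   difference of squared angles less its leading term, and a correction of order 5 from replacing
   the cosine by 1. *)
apply (bigO_pow_ext _ _ (fun k => / cos (angle (S k)) *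
  ((cos (angle k) - 1 + angle k ^ 2 / 2)
   - (cos (angle (S k)) - 1 + angle (S k) ^ 2 / 2)
   - (angle k ^ 2 / 2 - angle (S k) ^ 2 / 2 - PI ^ 2 / INR k ^ 3)
   + PI ^ 2 * (/ INR k ^ 3 * (cos (angle (S k)) - 1))))).
- intros k Hk; rewrite s_eq.
  pose proof (INR_pos k ltac:(lia)); pose proof (cos_angle_ge (S k) ltac:(lia)); field; lra.
- apply (bigO_pow_mul 0 4).
  + apply (bigO_pow_shift 0 (fun k => / cos (angle k))), inv_cos_bigO.
  + apply bigO_pow_add.
    * apply bigO_pow_sub; [now apply bigO_pow_sub | apply angle_sq_diff_bigO].
    * apply bigO_pow_scal, (bigO_pow_weaken 5); [lia|].
      apply (bigO_pow_mul 3 2); auto; apply bigO_pow_inv.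
Qed.

Lemma inv_one_minus_le (t : R) : 0 <= t <= 1 / 2 -> / (1 - t) <= 1 + t + 2 * t ^ 2.
Proof.
intros Ht; apply Rmult_le_reg_r with (1 - t); [lra|]; rewrite Rinv_l by lra; nra.
Qed.

(** The bounds 1 + t^2 and 1 / (1 - t^2) differ by O(t^4). The order 3 comes from replacing the
    angle by PI / k. *)
Lemma inv_cos2_bigO : bigO_pow 3 (fun k => / cos (angle k) ^ 2 - 1 - PI ^ 2 / INR k ^ 2).
Proof.
apply (bigO_pow_ext _ _ (fun k => (/ cos (angle k) ^ 2 - 1 - angle k ^ 2)
   + (angle k ^ 2 - PI ^ 2 / INR k ^ 2))); [intros; ring|].
apply bigO_pow_add; [|apply angle_sq_bigO].
apply (bigO_pow_weaken 4); [lia|].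
apply (bigO_pow_dom _ _ (fun k => (angle k ^ 2) ^ 2) 2);
  [|apply (bigO_pow_square 2), angle_sq_bigO_2].
destruct (bigO_pow_small _ _ (1 / 2) ltac:(lra) angle_sq_bigO_2) as [N HN].
exists (S N); intros k Hk; specialize (HN k ltac:(lia)).
pose proof (pow2_ge_0 (angle k)); pose proof (pow2_ge_0 (angle k ^ 2)).
rewrite Rabs_pos_eq in HN by easy.
pose proof (angle_le_2 k); pose proof (cos_angle_ge k ltac:(lia)).
pose proof (inv_cos2_ge (angle k) ltac:(lra) ltac:(lra)).
pose proof (inv_cos2_le (angle k) ltac:(nra)).
pose proof (inv_one_minus_le (angle k ^ 2) ltac:(lra)).
rewrite !Rabs_pos_eq; lra.
Qed.

(** Of the 3 PI^2 / k^2 in 4 xi_k, two parts come from [X], as 2k(1 - s_k) is about 2 PI^2 / k^2,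
    and one from [Y]. The factor k lowers the order 4 of the error in s_k to 3. *)
Lemma xi_bigO : bigO_pow 3 (fun k => xi_ k - (1 / 4 + 3 * PI ^ 2 / (4 * INR k ^ 2))).
Proof.
set (X := fun k => / s_ k ^ (2 * k)); set (Y := fun k => / cos (angle k) ^ 2).
set (p := fun k => PI ^ 2 * / INR k ^ 2).
set (d := fun k => 2 * (INR k * (1 - s_ k))).
assert (Hp : bigO_pow 2 p) by apply bigO_pow_scal, bigO_pow_inv.
assert (Hd : bigO_pow 3 (fun k => d k - 2 * p k)).
{ apply (bigO_pow_ext _ _ (fun k => -2 * (INR k * (s_ k - (1 - PI ^ 2 / INR k ^ 3))))).
  - intros k Hk; unfold d, p; pose proof (INR_pos k ltac:(lia)); field; lra.
  - apply bigO_pow_scal, bigO_pow_mul_INR, s_bigO. }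
assert (Hd2 : bigO_pow 2 d).
{ apply (bigO_pow_ext _ _ (fun k => (d k - 2 * p k) + 2 * p k)); [intros; ring|].
  apply bigO_pow_add; [apply (bigO_pow_weaken 3); auto | now apply bigO_pow_scal]. }
assert (HX : bigO_pow 3 (fun k => X k - 1 - 2 * p k)).
{ apply (bigO_pow_ext _ _ (fun k => (X k - 1 - d k) + (d k - 2 * p k))); [intros; ring|].
  apply bigO_pow_add; auto; apply (bigO_pow_weaken 4); [lia|].
  apply (bigO_pow_dom _ _ (fun k => d k ^ 2) 2); [|now apply (bigO_pow_square 2)].
  destruct (bigO_pow_small _ _ (1 / 2) ltac:(lra) Hd2) as [N HN].
  exists (S N); intros k Hk; specialize (HN k ltac:(lia)).
  pose proof (s_bounds k ltac:(lia)) as Hs; pose proof (INR_pos k ltac:(lia)) as Hk0.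
  assert (Hd0 : 0 <= d k) by (unfold d; nra).
  rewrite Rabs_pos_eq in HN by easy.
  assert (E : INR (2 * k) * (1 - s_ k) = d k)
    by (unfold d; rewrite mult_INR; simpl (INR 2); ring).
  pose proof (inv_pow_ge (1 - s_ k) (2 * k) ltac:(lra)) as H1.
  pose proof (inv_pow_le (1 - s_ k) (2 * k) ltac:(lra) ltac:(lra)) as H2.
  rewrite E in H1, H2; replace (1 - (1 - s_ k)) with (s_ k) in H1, H2 by ring.
  fold (X k) in H1, H2.
  pose proof (inv_one_minus_le (d k) ltac:(lra)); pose proof (pow2_ge_0 (d k)).
  rewrite !Rabs_pos_eq; lra. }
assert (HY : bigO_pow 3 (fun k => Y k - 1 - p k)) by exact inv_cos2_bigO.
assert (HY0 : bigO_pow 0 Y).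
{ apply (bigO_pow_ext _ _ (fun k => (/ cos (angle k)) ^ 2)).
  - intros k Hk; unfold Y; now rewrite pow_inv.
  - apply (bigO_pow_square 0), inv_cos_bigO. }
(* The bracket equals [X k * Y k - 1 - 3 * p k], arranged so that each summand has order at least
   3. *)
apply (bigO_pow_ext _ _ (fun k => 1 / 4 *
  ((X k - 1 - 2 * p k) * Y k + (1 + 2 * p k) * (Y k - 1 - p k) + 2 * p k ^ 2))).
- intros k Hk; unfold xi_; rewrite x_factor by (auto; apply s_bounds; auto).
  fold (X k); fold (Y k); unfold p; pose proof (INR_pos k ltac:(lia)); field; lra.
- apply bigO_pow_scal, bigO_pow_add; [apply bigO_pow_add|].
  + now apply (bigO_pow_mul 3 0).
  + apply (bigO_pow_mul 0 3); auto; apply bigO_pow_add; [apply bigO_pow_const|].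
    apply bigO_pow_scal, (bigO_pow_weaken 2); auto.
  + apply bigO_pow_scal, (bigO_pow_weaken 4); [lia|]; now apply (bigO_pow_square 2).
Qed.

(** * The critical point as [s] tends to 1 *)

(* With [w = (1 - s)^(1/3)] and [B = PI^(2/3)] the minimum over real [k] of the
   expansion [(1 + 2 k w^3 + B^3 / k^2) / 4] of [x_ k s] is at [k = B / w]. *)
Lemma x_min_ge (w B : R) (k : nat) :
  0 < w < 1 -> 0 < B -> B ^ 3 = PI ^ 2 -> (1 <= k)%nat ->
  (1 + 3 * B * w ^ 2) / 4 - w ^ 3 <= x_ k (1 - w ^ 3).
Proof.
intros Hw HB HB3 Hk.
assert (Hw3 : 0 < w ^ 3 < 1) by (split; [apply pow_lt; lra | nra]).
apply Rle_trans with (2 := x_ge k (1 - w ^ 3) ltac:(lra) Hk).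
replace (1 - (1 - w ^ 3)) with (w ^ 3) by ring.
(* The angle is PI / K while the power of [s] involves [K - 2]; this shift is the source of the
   error term [w ^ 3]. *)
set (K := INR (k + 2)).
assert (HK : INR k = K - 2) by (unfold K; rewrite plus_INR; simpl; ring).
assert (HK0 : 0 < K) by (apply INR_pos; lia).
assert (Ha : angle k ^ 2 = B ^ 3 / K ^ 2) by (rewrite HB3; unfold angle; fold K; field; lra).
(* The inequality of arithmetic and geometric means for K w^3, K w^3 and B^3 / K^2, with the
   difference written as an explicit non-negative term. *)
assert (Hamgm : 3 * B * w ^ 2 <= 2 * K * w ^ 3 + B ^ 3 / K ^ 2).
{ set (v := K * w).
  assert (Hv : 0 < v) by (apply Rmult_lt_0_compat; lra).
  replace (2 * K * w ^ 3 + B ^ 3 / K ^ 2)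
    with (3 * B * w ^ 2 + (v - B) ^ 2 * (2 * v + B) / K ^ 2)
    by (unfold v; field; lra).
  assert (0 <= (v - B) ^ 2 * (2 * v + B) / K ^ 2); [|lra].
  apply Rdiv_le_0_compat; [|now apply pow_lt].
  apply Rmult_le_pos; [apply pow2_ge_0 | lra]. }
rewrite Ha, HK.
assert (0 <= INR k) by apply pos_INR.
assert (0 <= B ^ 3 / K ^ 2) by (rewrite <- Ha; apply pow2_ge_0).
assert (0 <= (K - 2) * w ^ 3) by (apply Rmult_le_pos; lra).
nra.
Qed.

(** The index is the integer part of the real minimiser B / w. As k <= B / w < k + 2, both small
    quantities are bounded through z = B w^2: 2k w^3 <= 2z and the squared angle is at most z. The
    constant 5 is large enough for 1 / ((1 - 2z)(1 - z)) <= 1 + 3z + 20 z^2 when z <= 1/8. *)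
Lemma x_min_le (w B : R) :
  0 < w < 1 -> 1 <= B -> B * w ^ 2 <= 1 / 8 -> B ^ 3 = PI ^ 2 ->
  exists k, (1 <= k)%nat /\
    x_ k (1 - w ^ 3) <= (1 + 3 * B * w ^ 2) / 4 + 5 * B ^ 2 * w ^ 4.
Proof.
intros Hw HB Hz HB3.
assert (Hw3 : 0 < w ^ 3 < 1) by (split; [apply pow_lt; lra | nra]).
assert (HBw : 1 < B / w) by (apply Rlt_div_r; lra).
destruct (nfloor_ex (B / w) ltac:(lra)) as [k [Hk1 Hk2]].
assert (Hk : (1 <= k)%nat) by (destruct k; [simpl in Hk2; lra | lia]).
exists k; split; auto.
set (z := B * w ^ 2) in *.
assert (Hz0 : 0 < z) by (apply Rmult_lt_0_compat; [lra | apply pow_lt; lra]).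
assert (Hkz : 2 * INR k * w ^ 3 <= 2 * z).
{ replace (2 * z) with (2 * (B / w) * w ^ 3) by (unfold z; field; lra).
  apply Rmult_le_compat_r; lra. }
assert (Haz : angle k ^ 2 <= z).
{ replace z with (B ^ 3 / (B / w) ^ 2) by (unfold z; field; lra).
  unfold angle; rewrite HB3.
  replace ((PI / INR (k + 2)) ^ 2) with (PI ^ 2 * / INR (k + 2) ^ 2)
    by (field; apply not_0_INR; lia).
  apply Rmult_le_compat_l; [apply pow2_ge_0|].
  apply Rinv_le_contravar; [apply pow_lt; lra|].
  apply pow_incr; rewrite plus_INR; simpl (INR 2); lra. }
pose proof (angle_pos k) as Ha0.
pose proof (x_le k (1 - w ^ 3) ltac:(lra) Hk) as Hx.
replace (1 - (1 - w ^ 3)) with (w ^ 3) in Hx by ring.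
specialize (Hx ltac:(lra) ltac:(nra)).
apply Rle_trans with (1 := Hx).
apply Rle_trans with (/ (1 - 2 * z) * / (1 - z) / 4).
- apply Rmult_le_compat_r; [lra|]; apply Rmult_le_compat.
  + apply Rlt_le, Rinv_0_lt_compat; lra.
  + apply Rlt_le, Rinv_0_lt_compat; lra.
  + apply Rinv_le_contravar; lra.
  + apply Rinv_le_contravar; lra.
- replace (5 * B ^ 2 * w ^ 4) with (5 * z ^ 2) by (unfold z; ring).
  replace (3 * B * w ^ 2) with (3 * z) by (unfold z; ring).
  rewrite <- Rinv_mult; apply Rmult_le_reg_l with ((1 - 2 * z) * (1 - z)); [nra|].
  unfold Rdiv at 1; rewrite <- Rmult_assoc, Rinv_r by nra.
  nra.
Qed.

Lemma x_c_asymptotic :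
  is_domin (at_left 1)
    (fun s : R => Rpower (1 - s) (2 / 3))
    (fun s : R => real (x_c s)
       - (1 / 4 + 3 * Rpower PI (2 / 3) / 4 * Rpower (1 - s) (2 / 3))).
Proof.
intros eps; set (B := Rpower PI (2 / 3)).
pose proof PI_RGT_0; assert (HPI : 1 < PI) by (pose proof PI2_1; lra).
assert (HB3 : B ^ 3 = PI ^ 2).
{ unfold B; rewrite <- (Rpower_pow 3) by apply exp_pos.
  rewrite Rpower_mult, <- (Rpower_pow 2) by lra; f_equal; simpl; field. }
assert (HB : 1 <= B).
{ apply Rnot_lt_le; intros H1; assert (0 < B) by apply exp_pos.
  assert (B ^ 3 < 1) by nra; nra. }
(* The three bounds serve, in order, to bring the total error (1 + 5 B^2) w^3 below eps w^2, to meet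
   the smallness hypothesis of [x_min_le], and to keep [s] positive. As w is the cube root of 1 - s,
   the neighbourhood has radius [c ^ 3]. *)
set (c := Rmin (Rmin (eps / (1 + 5 * B ^ 2)) (/ (8 * B))) (1 / 2)).
pose proof (cond_pos eps) as Heps.
assert (Hc : 0 < c).
{ repeat apply Rmin_glb_lt; [apply Rdiv_lt_0_compat; nra | apply Rinv_0_lt_compat; lra | lra]. }
assert (Hc1 : c <= eps / (1 + 5 * B ^ 2))
  by (apply Rle_trans with (1 := Rmin_l _ _), Rmin_l).
assert (Hc2 : c <= / (8 * B)) by (apply Rle_trans with (1 := Rmin_l _ _), Rmin_r).
assert (Hc3 : c <= 1 / 2) by apply Rmin_r.
assert (Hc4 : 0 < c ^ 3) by now apply pow_lt.
exists (mkposreal _ Hc4); intros s Hs Hs1.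
assert (Hs2 : 1 - s < c ^ 3).
{ apply Rle_lt_trans with (2 := Hs); change (1 - s <= Rabs (s - 1)).
  rewrite Rabs_minus_sym; apply Rle_abs. }
set (w := Rpower (1 - s) (1 / 3)).
assert (Hw0 : 0 < w) by apply exp_pos.
assert (Hw3 : w ^ 3 = 1 - s).
{ unfold w; rewrite <- (Rpower_pow 3) by apply exp_pos.
  rewrite Rpower_mult; replace (1 / 3 * INR 3) with 1 by (simpl; field).
  apply Rpower_1; lra. }
assert (Hw2 : Rpower (1 - s) (2 / 3) = w ^ 2).
{ unfold w; rewrite <- (Rpower_pow 2) by apply exp_pos.
  rewrite Rpower_mult; f_equal; simpl; field. }
assert (Hwc : w < c).
{ apply Rnot_le_lt; intros H1; pose proof (pow_incr c w 3 ltac:(lra)); lra. }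
assert (Hc31 : c ^ 3 < 1) by nra.
destruct (x_c_attained s ltac:(lra)) as [k [Hk [E Hmin]]].
rewrite E, Hw2; change (Rabs (x_ k s - (1 / 4 + 3 * B / 4 * w ^ 2)) <= eps * Rabs (w ^ 2)).
rewrite (Rabs_pos_eq (w ^ 2)) by apply pow2_ge_0.
replace s with (1 - w ^ 3) in * by lra.
assert (HBw : B * w <= 1 / 8).
{ apply Rle_trans with (B * / (8 * B)); [apply Rmult_le_compat_l; lra | right; field; lra]. }
(* The upper bound holds at [j] and passes to the minimiser [k]; the lower bound holds at every
   index. *)
destruct (x_min_le w B ltac:(lra) HB ltac:(nra) HB3) as [j [Hj Hup]].
specialize (Hmin j Hj).
pose proof (x_min_ge w B k ltac:(lra) ltac:(lra) HB3 Hk) as Hlow.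
assert (Hew : w * (1 + 5 * B ^ 2) <= eps).
{ apply Rle_div_r; [nra|]; lra. }
assert (Hw30 : 0 < w ^ 3) by now apply pow_lt.
assert (Hw43 : w ^ 4 <= w ^ 3) by nra.
assert (HwB : 5 * B ^ 2 * w ^ 4 <= 5 * B ^ 2 * w ^ 3) by (apply Rmult_le_compat_l; nra).
assert (Hfin : w ^ 3 + 5 * B ^ 2 * w ^ 3 <= eps * w ^ 2).
{ replace (w ^ 3 + 5 * B ^ 2 * w ^ 3) with (w * (1 + 5 * B ^ 2) * w ^ 2) by ring.
  apply Rmult_le_compat_r; [apply pow2_ge_0 | easy]. }
assert (0 <= 5 * B ^ 2 * w ^ 3) by (apply Rmult_le_pos; nra).
apply Rabs_le; split; lra.
Qed.

Theorem mainTheorem4 :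
  (forall s : R, 0 < s < 1 ->
     exists k : nat, (1 <= k)%nat
       /\ x_c s = Finite (x_ k s)
       /\ (forall j : nat, (1 <= j)%nat -> x_ k s <= x_ j s))
  /\ (forall k : nat, (1 <= k)%nat ->
        0 < s_ k < 1
        /\ x_ k (s_ k) = x_ (S k) (s_ k)
        /\ (forall s : R, 0 < s < s_ k -> x_ k s < x_ (S k) s)
        /\ (forall s : R, s_ k < s < 1 -> x_ (S k) s < x_ k s))
  /\ bigO_seq (fun k => s_ k - (1 - PI ^ 2 / INR k ^ 3))
              (fun k => / INR k ^ 4)
  /\ bigO_seq (fun k => xi_ k - (1 / 4 + 3 * PI ^ 2 / (4 * INR k ^ 2)))
              (fun k => / INR k ^ 3)
  /\ is_domin (at_left 1)
       (fun s : R => Rpower (1 - s) (2 / 3))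
       (fun s : R => real (x_c s)
          - (1 / 4 + 3 * Rpower PI (2 / 3) / 4 * Rpower (1 - s) (2 / 3))).
Proof.
split; [exact x_c_attained|].
split; [exact x_crossing|].
split; [exact s_bigO|].
split; [exact xi_bigO | exact x_c_asymptotic].
Qed.
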